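(* The following two problems are $\Pi^1_1$-hard: (1) given a timed Büchi automaton $\mathcal{A}$, determine whether $L_\omega(\mathcal{A})$ is accepted by some deterministic timed Büchi automaton; (2) given a timed Büchi automaton $\mathcal{A}$ over a finite alphabet $\Sigma$, determine whether the complement $L_\omega(\mathcal{A})^c=(\mathcal{R}\times\Sigma)^\omega\setminus L_\omega(\mathcal{A})$ is accepted by some timed Büchi automaton.
   Context: $\mathcal{R}$ denotes the set of positive reals. An infinite timed word over a finite alphabet $\Sigma$ is a sequence $t_1.a_1.t_2.a_2.t_3.a_3\ldots$ with $t_i\in\mathcal{R}$ and $a_i\in\Sigma$; the set of these is $(\mathcal{R}\times\Sigma)^\omega$. A timed Büchi automaton (Alur–Dill) has finitely many real-valued clocks (growing at rate 1), finitely many states with initial states and a set of accepting states, and finitely many transitions each labelled by a letter of $\Sigma$, carrying a diagonal-free clock guard (Boolean combination of constraints $x\sim c$, $c$ a nonnegative integer) and a set of clocks to reset; an infinite timed word is accepted if some run on it visits accepting states infinitely often, and $L_\omega(\mathcal{A})$ is the set of accepted infinite timed words. It is deterministic if it has a single start state and transitions from the same state with the same label have mutually exclusive guards. $\Pi^1_1$ is the corresponding class of the analytical hierarchy; a problem is $\Pi^1_1$-hard if every $\Pi^1_1$ set reduces to it. *)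

(* Defs.v *)
From HB Require Import structures.
From mathcomp Require Import all_boot all_order all_algebra.
From mathcomp Require Import boolp classical_sets reals interval_inference.

Set Implicit Arguments.
Unset Strict Implicit.
Unset Printing Implicit Defensive.

Import Order.TTheory GRing.Theory Num.Theory.

Local Open Scope classical_set_scope.
Local Open Scope nat_scope.

(* Total recursive functions: the closure of the basic functions under
   composition, primitive recursion and minimization of regular functions
   (those for which the minimum exists for every value of the parameters). *)
Inductive recursive : forall k, (k.-tuple nat -> nat) -> Prop :=
| rec_zero k : @recursive k (fun=> 0)
| rec_succ : @recursive 1 (fun v => (thead v).+1)
| rec_proj k (i : 'I_k) : @recursive k (fun v => tnth v i)
| rec_comp m k (g : m.-tuple nat -> nat) (h : 'I_m -> k.-tuple nat -> nat) :
    recursive g -> (forall i, recursive (h i)) ->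
    recursive (fun v => g [tuple h i v | i < m])
| rec_primrec k (f : k.-tuple nat -> nat) (g : k.+2.-tuple nat -> nat) :
    recursive f -> recursive g ->
    @recursive k.+1 (fun v =>
      iteri (thead v) (fun y r => g [tuple of y :: r :: behead_tuple v])
        (f (behead_tuple v)))
| rec_min k (f : k.+1.-tuple nat -> nat) (g : k.-tuple nat -> nat) :
    recursive f ->
    (forall v, f [tuple of g v :: v] = 0 /\
       (forall y, y < g v -> f [tuple of y :: v] <> 0)) ->
    recursive g
| rec_ext k (f g : k.-tuple nat -> nat) : f =1 g -> recursive f -> recursive g.

Definition computable (f : nat -> nat) : Prop :=
  @recursive 1 (fun v => f (thead v)).

(* Variables of both sorts are de Bruijn indices, counted separately for the
   number variables and the set variables. *)
Inductive term :=
| TVar of nat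
| TZero
| TSucc of term
| TAdd of term & term
| TMul of term & term.

Inductive form :=
| FEq of term & term
| FLt of term & term
| FMem of term & nat
| FNot of form
| FAnd of form & form
| FOr of form & form
| FImp of form & form
| FAll of form
| FEx of form
| FAllSet of form
| FExSet of form.

Definition scons (T : Type) (x : T) (e : nat -> T) (i : nat) : T :=
  if i is j.+1 then e j else x.

Fixpoint teval (e : nat -> nat) (t : term) : nat :=
  match t with
  | TVar i => e i
  | TZero => 0
  | TSucc t => (teval e t).+1
  | TAdd t u => teval e t + teval e u
  | TMul t u => teval e t * teval e u
  end.

Fixpoint holds (e : nat -> nat) (E : nat -> set nat) (phi : form) : Prop :=
  match phi with
  | FEq t u => teval e t = teval e u
  | FLt t u => teval e t < teval e u
  | FMem t X => E X (teval e t)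
  | FNot p => ~ holds e E p
  | FAnd p q => holds e E p /\ holds e E q
  | FOr p q => holds e E p \/ holds e E q
  | FImp p q => holds e E p -> holds e E q
  | FAll p => forall n : nat, holds (scons n e) E p
  | FEx p => exists n : nat, holds (scons n e) E p
  | FAllSet p => forall X : set nat, holds e (scons X E) p
  | FExSet p => exists X : set nat, holds e (scons X E) p
  end.

Fixpoint arithmetical (phi : form) : bool :=
  match phi with
  | FEq _ _ | FLt _ _ | FMem _ _ => true
  | FNot p | FAll p | FEx p => arithmetical p
  | FAnd p q | FOr p q | FImp p q => arithmetical p && arithmetical q
  | FAllSet _ | FExSet _ => false
  end.

Fixpoint pi11_form (phi : form) : bool :=
  if phi is FAllSet p then pi11_form p else arithmetical phi.

(* Lightface: the quantification over [e] and [E] forbids parameters, only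
   the number variable 0 is effectively free in the defining formula. *)
Definition pi11 (B : set nat) : Prop :=
  exists2 phi, pi11_form phi &
    forall n (e : nat -> nat) (E : nat -> set nat),
      B n <-> holds (scons n e) E phi.

(* A decision problem is a set [P] of instances, which [code] presents as
   natural numbers; the reduction is many-one. *)
Definition pi11_hard (T : Type) (code : T -> nat) (P : set T) : Prop :=
  forall B : set nat, pi11 B ->
    exists2 F : nat -> T, computable (fun n => code (F n)) &
      forall n, B n <-> P (F n).

Variant cmp := CLt | CLe | CEq | CGe | CGt.

(* Guards over the clocks ['I_m]. *)
Inductive guard (m : nat) :=
| GTrue
| GCmp of 'I_m & cmp & nat
| GNot of guard m
| GAnd of guard m & guard m
| GOr of guard m & guard m.
Arguments GTrue {m}.

Definition cmp_code (r : cmp) : nat :=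
  match r with CLt => 0 | CLe => 1 | CEq => 2 | CGe => 3 | CGt => 4 end.

Fixpoint guard_code m (g : guard m) : nat :=
  match g with
  | GTrue => CodeSeq.code [:: 0]
  | GCmp x r c => CodeSeq.code [:: 1; val x; cmp_code r; c]
  | GNot g => CodeSeq.code [:: 2; guard_code g]
  | GAnd g h => CodeSeq.code [:: 3; guard_code g; guard_code h]
  | GOr g h => CodeSeq.code [:: 4; guard_code g; guard_code h]
  end.

(* Transitions over the letters ['I_k], states ['I_n] and clocks ['I_m]. *)
Record transition (k n m : nat) := Transition {
  source : 'I_n;
  label : 'I_k;
  cond : guard m;
  resets : {set 'I_m};
  target : 'I_n }.

Definition ord_set_code n (A : {set 'I_n}) : nat :=
  CodeSeq.code [seq val i | i <- enum A].

Definition transition_code k n m (e : transition k n m) : nat :=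
  CodeSeq.code [:: val (source e); val (label e); guard_code (cond e);
                   ord_set_code (resets e); val (target e)].

Lemma code_inj : injective CodeSeq.code.
Proof. exact: can_inj CodeSeq.codeK. Qed.

Lemma cmp_code_inj : injective cmp_code.
Proof. by case; case. Qed.

Lemma guard_code_inj m : injective (@guard_code m).
Proof.
elim=> [|x r c|g IHg|g IHg h IHh|g IHg h IHh] [|y s d|g'|g' h'|g' h'] //.
all: move=> /code_inj e; case: e => //.
- by move=> /val_inj -> /cmp_code_inj -> ->.
- by move=> /IHg ->.
- by move=> /IHg -> /IHh ->.
- by move=> /IHg -> /IHh ->.
Qed.

Lemma ord_set_code_inj n : injective (@ord_set_code n).
Proof.
move=> A B /code_inj /(inj_map val_inj) eAB.
by apply/setP => i; rewrite -[i \in A]mem_enum eAB mem_enum.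
Qed.

Lemma transition_code_inj k n m : injective (@transition_code k n m).
Proof.
move=> [s a g r t] [s' a' g' r' t'] /code_inj[] /=.
by move=> /val_inj-> /val_inj-> /guard_code_inj-> /ord_set_code_inj-> /val_inj->.
Qed.

HB.instance Definition _ k n m :=
  Equality.copy (transition k n m) (inj_type (@transition_code_inj k n m)).

(* Timed Buchi automata over the alphabet ['I_k]. *)
Record tba (k : nat) := TBA {
  nstates : nat;
  nclocks : nat;
  initial : {set 'I_nstates};
  accepting : {set 'I_nstates};
  transitions : seq (transition k nstates nclocks) }.

(* The alphabet is part of the input. *)
Definition tba_instance : Type := {k : nat & tba k}.

Definition tba_code (A : tba_instance) : nat :=
  CodeSeq.code [:: tag A; nstates (tagged A); nclocks (tagged A);
    ord_set_code (initial (tagged A)); ord_set_code (accepting (tagged A));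
    CodeSeq.code (map (@transition_code _ _ _) (transitions (tagged A)))].

Lemma tba_code_inj : injective tba_code.
Proof.
move=> [k [n m i a t]] [k' [n' m' i' a' t']] /code_inj[] /= ek en em.
case: _ / ek t' => t'; case: _ / en i' a' t' => i' a' t'.
case: _ / em t' => t'.
move=> /ord_set_code_inj-> /ord_set_code_inj->.
by move=> /code_inj /(inj_map (@transition_code_inj _ _ _)) ->.
Qed.

Section Semantics.
Variable R : realType.
Local Open Scope ring_scope.

(* Infinite timed words t_1.a_1.t_2.a_2 ...: [w i] is the pair formed by the
   time elapsed just before the event of index [i] and this event. No
   divergence of time is required. *)
Definition timed_word (k : nat) : Type := nat -> {posnum R} * 'I_k.

Definition cmp_sat (r : cmp) (x y : R) : bool :=
  match r with
  | CLt => x < y | CLe => x <= y | CEq => x == y | CGe => x >= y | CGt => x > y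
  end.

Fixpoint guard_sat m (v : 'I_m -> R) (g : guard m) : bool :=
  match g with
  | GTrue => true
  | GCmp x r c => cmp_sat r (v x) c%:R
  | GNot g => ~~ guard_sat v g
  | GAnd g h => guard_sat v g && guard_sat v h
  | GOr g h => guard_sat v g || guard_sat v h
  end.

(* [q i] and [v i] are the state and the clock valuation reached after [i]
   events, [e i] is the transition taken at the event of index [i]. *)
Definition is_run k (A : tba k) (w : timed_word k)
    (q : nat -> 'I_(nstates A)) (v : nat -> 'I_(nclocks A) -> R)
    (e : nat -> transition k (nstates A) (nclocks A)) : Prop :=
  [/\ q 0%N \in initial A,
      (forall x, v 0%N x = 0) &
      forall i, let elapsed x := v i x + (w i).1%:num in
        [/\ e i \in transitions A,
            source (e i) = q i /\ target (e i) = q i.+1,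
            label (e i) = (w i).2,
            guard_sat elapsed (cond (e i)) &
            forall x, v i.+1 x = if x \in resets (e i) then 0 else elapsed x]].

Definition lang k (A : tba k) : set (timed_word k) :=
  [set w | exists q v e, @is_run k A w q v e /\
     forall N : nat, exists2 i : nat, (N <= i)%N & q i \in accepting A].

Definition deterministic k (A : tba k) : Prop :=
  #|initial A| = 1%N /\
  forall e f, e \in transitions A -> f \in transitions A -> e <> f ->
    source e = source f -> label e = label f ->
    forall v : 'I_(nclocks A) -> R, (forall x, 0 <= v x) ->
      ~ (guard_sat v (cond e) /\ guard_sat v (cond f)).

Definition determinizable k (A : tba k) : Prop :=
  exists2 D : tba k, deterministic D & lang D = lang A.

Definition complementable k (A : tba k) : Prop :=
  exists B : tba k, lang B = ~` lang A.

End Semantics.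

(* Main.v *)
(** By Tarski's truth definition, the complement of a Pi^1_1 set consists of the
    [n] for which some oracle [W] satisfies [forall m, exists y, Q W n m y] with
    [Q] decidable in [W]: [W] stores the set variables and the truth values of
    the quantified subformulas. Equivalently, a fixed counter machine with
    oracle [W], started on [n], visits a given state infinitely often.

    The run of such a machine is written as a timed word in which the
    configuration at time [j] is a row of [j.+1] cells placed in the time
    interval [[j, j + 1)], each row being copied, up to local changes, exactly
    one time unit later. A timed automaton guesses and checks a violation of
    this format, so that it accepts all words except the encodings of the
    recurrent runs; the input [n] only occurs as a constant of its guards.

    In front of the encoding, a block of blank letters is allowed, and the word
    is also accepted when two of these letters are at distance exactly 1. Without
    recurrent run, the automaton is universal. With one, an automaton for the
    complement, or a deterministic one, would have to remember the times of an
    unbounded number of blank letters with its finitely many clocks: an event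
    whose time is not stored can be moved to distance 1 of an earlier one
    without affecting the run. *)

From HB Require Import structures.
From mathcomp Require Import all_boot all_order all_algebra.
From mathcomp Require Import boolp classical_sets reals interval_inference.
From mathcomp Require Import zify lra.
Require Import Defs.

Set Implicit Arguments.
Unset Strict Implicit.
Unset Printing Implicit Defensive.

Import Order.TTheory GRing.Theory Num.Theory.

Local Open Scope classical_set_scope.
Local Open Scope nat_scope.

(** * Computable codes *)

Lemma recursive_comp1 k (f : nat -> nat) (g : k.-tuple nat -> nat) :
  computable f -> recursive g -> recursive (fun v => f (g v)).
Proof.
move=> cf rg; apply: rec_ext (rec_comp (h := fun _ : 'I_1 => g) cf (fun=> rg)).
by move=> v /=; rewrite /thead tnth_mktuple.
Qed.

Lemma computable_comp f g :
  computable f -> computable g -> computable (fun n => f (g n)).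
Proof. exact: recursive_comp1. Qed.

Lemma computable_succ : computable succn.
Proof. exact: rec_succ. Qed.

Lemma computable_const c : computable (fun=> c).
Proof.
elim: c => [|c IHc]; first exact: rec_zero.
exact: computable_comp computable_succ IHc.
Qed.

Lemma computable_double : computable double.
Proof.
have rSS : @recursive 2 (fun v => (tnth v (lift ord0 ord0)).+2).
  do 2!apply: (recursive_comp1 computable_succ).
  exact: (rec_proj (lift ord0 ord0 : 'I_2)).
apply: rec_ext (rec_primrec (rec_zero 0) rSS) => v /=.
by elim: (thead v) => [|n IHn] //=; rewrite IHn.
Qed.

Lemma recursive_code_cons :
  @recursive 2 (fun v => 2 ^ thead v * (tnth v (lift ord0 ord0)).*2.+1).
Proof.
have r_step : @recursive 3 (fun v => (tnth v (lift ord0 ord0)).*2).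
  exact: recursive_comp1 computable_double (rec_proj (lift ord0 ord0 : 'I_3)).
have r_base := computable_comp computable_succ computable_double.
apply: rec_ext (rec_primrec r_base r_step) => v /=.
have -> : thead (behead_tuple v) = tnth v (lift ord0 ord0).
  by rewrite /thead !(tnth_nth 0) /= nth_behead.
elim: (thead v) => [|n IHn] /=; first by rewrite mul1n.
by rewrite (tnth_nth 0) /= IHn expnS -mulnA mul2n.
Qed.

Lemma computable_code_cons (f : nat -> nat) (s : nat -> seq nat) :
  computable f -> computable (fun n => CodeSeq.code (s n)) ->
  computable (fun n => CodeSeq.code (f n :: s n)).
Proof.
move=> cf cs.
pose args (i : 'I_2) n := if i == ord0 then f n else CodeSeq.code (s n).
have cargs i : computable (args i) by rewrite /args; case: (i == ord0).
apply: rec_ext (rec_comp recursive_code_cons cargs) => v /=.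
by rewrite /thead !tnth_mktuple.
Qed.

Lemma computable_code_map (I : Type) (s : seq I) (f : I -> nat -> nat) :
  (forall i, computable (f i)) ->
  computable (fun n => CodeSeq.code [seq f i n | i <- s]).
Proof.
move=> cf; elim: s => [|i s IHs]; first exact: computable_const.
exact: computable_code_cons (cf i) IHs.
Qed.

(** * Runs of timed automata *)

Definition infinitely_often (P : nat -> Prop) : Prop :=
  forall N, exists2 i, N <= i & P i.

Section TimedWords.
Variables (R : realType) (k : nat).
Implicit Type w : timed_word R k.
Local Open Scope ring_scope.

Definition elapsed w (i : nat) : R := \sum_(j < i) (w j).1%:num.

Definition event_time w (i : nat) : R := elapsed w i.+1.

Lemma elapsed0 w : elapsed w 0 = 0.
Proof. by rewrite /elapsed big_ord0. Qed.

Lemma elapsedS w i : elapsed w i.+1 = elapsed w i + (w i).1%:num.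
Proof. by rewrite /elapsed big_ord_recr. Qed.

Lemma event_time0 w : event_time w 0 = (w 0%N).1%:num.
Proof. by rewrite /event_time elapsedS elapsed0 add0r. Qed.

Lemma event_timeS w i : event_time w i.+1 = event_time w i + (w i.+1).1%:num.
Proof. exact: elapsedS. Qed.

Lemma event_time_le w : {mono event_time w : i j / (i <= j)%N >-> i <= j}.
Proof.
have event_time_ltS i : event_time w i < event_time w i.+1.
  by rewrite event_timeS ltrDl.
exact: Order.NatMonotonyTheory.incnP event_time_ltS.
Qed.

Lemma event_time_lt w : {mono event_time w : i j / (i < j)%N >-> i < j}.
Proof. exact: leW_mono (event_time_le w). Qed.

Lemma event_time_inj w : injective (event_time w).
Proof. exact: inc_inj (event_time_le w). Qed.

Lemma event_time_gt0 w i : 0 < event_time w i.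
Proof.
by rewrite (@lt_le_trans _ _ (event_time w 0)) ?event_time_le // event_time0.
Qed.

Lemma word_of_times (T : nat -> R) (l : nat -> 'I_k) :
  0 < T 0%N -> (forall i, T i < T i.+1) ->
  exists w, event_time w =1 T /\ forall i, (w i).2 = l i.
Proof.
move=> T0 TS.
pose gap i := T i - (if i is j.+1 then T j else 0).
have delay i : exists d : {posnum R}, d%:num = gap i.
  have gap_gt0 : 0 < gap i by case: i => [|i]; rewrite /gap ?subr0 // subr_gt0.
  by exists (PosNum gap_gt0).
have [d dE] := choice delay.
exists (fun i => (d i, l i)); split=> //.
elim=> [|i IHi]; first by rewrite event_time0 /= dE /gap subr0.
by rewrite event_timeS IHi /= dE /gap addrC subrK.
Qed.

End TimedWords.

Section Runs.
Variables (R : realType) (k : nat).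
Implicit Type w : timed_word R k.
Local Open Scope ring_scope.

Section Resets.
Variables n m : nat.
Implicit Types e f : nat -> transition k n m.

Fixpoint last_reset e (i : nat) (x : 'I_m) : option nat :=
  if i is j.+1 then if x \in resets (e j) then Some j else last_reset e j x
  else None.

Lemma last_reset_lt e i x j : last_reset e i x = Some j -> (j < i)%N.
Proof. by elim: i => //= i IHi; case: ifP => [_ [<-]|_ /IHi/ltnW]. Qed.

Lemma last_reset_le e i i' x j : (i <= i')%N -> last_reset e i' x = Some j ->
  (j < i)%N -> last_reset e i x = Some j.
Proof.
move=> /subnKC <-; elim: (i' - i)%N => [|d IHd]; first by rewrite addn0.
by rewrite addnS /=; case: ifP => // _ [<-]; lia.
Qed.

Lemma eq_last_reset e f i x : (forall j, (j < i)%N -> e j = f j) ->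
  last_reset e i x = last_reset f i x.
Proof.
elim: i => //= i IHi ef; rewrite ef // IHi // => j ji.
exact: ef (ltnW ji).
Qed.

Definition reset_time w e i x : R := oapp (event_time w) 0 (last_reset e i x).

(* Value of the clock [x] at the event [i], before the resets. *)
Definition clock w e i x : R := event_time w i - reset_time w e i x.

Lemma reset_timeS w e i x : reset_time w e i.+1 x =
  if x \in resets (e i) then event_time w i else reset_time w e i x.
Proof. by rewrite /reset_time /=; case: ifP. Qed.

Lemma clock_ge0 w e i x : 0 <= clock w e i x.
Proof.
rewrite subr_ge0 /reset_time; case E: last_reset => [j|] /=.
  by rewrite event_time_le ltnW // (last_reset_lt E).
exact/ltW/event_time_gt0.
Qed.

Lemma eq_clock w w' e f i x : (forall j, (j <= i)%N -> w j = w' j) ->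
  (forall j, (j < i)%N -> e j = f j) -> clock w e i x = clock w' f i x.
Proof.
move=> ww' ef; rewrite /clock /reset_time -(eq_last_reset x ef).
have eq_time j : (j <= i)%N -> event_time w j = event_time w' j.
  move=> ji; rewrite /event_time /elapsed; apply: eq_bigr => -[q qj] _ /=.
  by rewrite ww' // (leq_trans _ ji).
rewrite eq_time //; case E: last_reset => [j|] //=.
by rewrite eq_time // ltnW // (last_reset_lt E).
Qed.

End Resets.

Section Automaton.
Variable A : tba k.
Implicit Types e f : nat -> transition k (nstates A) (nclocks A).

Definition run_step w e (i : nat) : Prop :=
  [/\ e i \in transitions A, target (e i) = source (e i.+1),
      label (e i) = (w i).2 & guard_sat (clock w e i) (cond (e i))].

Definition accepting_run w e : Prop :=
  [/\ source (e 0%N) \in initial A, forall i, run_step w e i &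
      infinitely_often (fun i => source (e i) \in accepting A)].

Lemma langP w : lang A w <-> exists e, accepting_run w e.
Proof.
split=> [[q [v [e [[q0 v0 he] acc]]]]|[e [e0 he acc]]].
  have sourceE i : source (e i) = q i by have [_ []] := he i.
  have clockE i x : v i x + (w i).1%:num = clock w e i x.
    elim: i => [|i IHi].
      by rewrite /clock /reset_time event_time0 v0 add0r subr0.
    have [_ _ _ _ ->] := he i; rewrite IHi /clock reset_timeS event_timeS.
    by case: ifP => _; rewrite addrAC ?subrr ?add0r.
  exists e; split=> [|i|N]; first by rewrite sourceE.
    have [ei [_ tei] li gi _] := he i; split; rewrite ?sourceE //.
    by rewrite (_ : clock w e i = fun x => v i x + (w i).1%:num) //; apply/funext.
  by have [i Ni ai] := acc N; exists i; rewrite ?sourceE.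
pose v i x := elapsed w i - reset_time w e i x.
have clockE i : (fun x => v i x + (w i).1%:num) = clock w e i.
  by apply/funext => x; rewrite /v /clock /event_time elapsedS addrAC.
exists (fun i => source (e i)), v, e; split=> //; split=> // [x|i].
  by rewrite /v /reset_time /= elapsed0 subr0.
have [ei tei li gi] := he i; split; rewrite ?clockE // => x.
rewrite (congr1 (@^~ x) (clockE i)) /v reset_timeS.
by case: ifP; rewrite ?subrr.
Qed.

Lemma eq_run_step w w' e p : (forall q, (q <= p)%N -> w q = w' q) ->
  run_step w e p <-> run_step w' e p.
Proof.
move=> ww'; rewrite /run_step ww' //.
by rewrite (_ : clock w e p = clock w' e p) //; apply/funext => x;
  apply: eq_clock.
Qed.

Lemma deterministic_run w e f L :
  deterministic R A -> source (e 0%N) \in initial A ->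
  source (f 0%N) \in initial A ->
  (forall i, (i < L)%N -> run_step w e i) ->
  (forall i, (i < L)%N -> run_step w f i) ->
  forall i, (i < L)%N -> e i = f i.
Proof.
move=> [init1 det] e0 f0 he hf i; elim/ltn_ind: i => i IHi iL.
have IH j : (j < i)%N -> e j = f j by move=> ji; apply: IHi => //; lia.
have [ei tei lei gei] := he i iL; have [fi tfi lfi gfi] := hf i iL.
apply: contrapT => ef; apply: (det _ _ ei fi ef _ _ (clock w e i)).
- case: i IH iL {IHi ei tei lei gei fi tfi lfi gfi ef} => [|i] IH iL.
    by move/eqP/cards1P: init1 e0 f0 => [q ->]; rewrite !inE => /eqP-> /eqP->.
  have [_ <- _ _] := he i (ltnW iL); have [_ <- _ _] := hf i (ltnW iL).
  by rewrite IH.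
- by rewrite lei lfi.
- by move=> x; exact: clock_ge0.
split=> //; rewrite (_ : clock w e i = clock w f i) //.
by apply/funext => x; apply: eq_clock.
Qed.

End Automaton.

Definition universal_tba : tba k := @TBA k 1 0 [set: 'I_1]%SET [set: 'I_1]%SET
  [seq Transition ord0 l GTrue finset.set0 ord0 | l <- enum 'I_k].

Lemma lang_universal : lang universal_tba = [set: timed_word R k].
Proof.
apply/seteqP; split=> // w _; apply/langP.
exists (fun i =>
  Transition ord0 (w i).2 GTrue finset.set0 ord0 : transition k 1 0).
split=> [|i|N]; first by rewrite inE.
  by split=> //; apply/mapP; exists (w i).2; rewrite ?mem_enum.
by exists N => //; rewrite inE.
Qed.

Lemma universal_deterministic : deterministic R universal_tba.
Proof.
split; first by rewrite cardsT card_ord.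
by move=> f g /mapP[a _ ->] /mapP[b _ ->] + _ /= ab; rewrite ab.
Qed.

Definition empty_tba : tba k := @TBA k 1 0 finset.set0 finset.set0 [::].

Lemma lang_empty : lang empty_tba = set0 :> set (timed_word R k).
Proof. by apply/seteqP; split=> // w /langP[e []]; rewrite inE. Qed.

End Runs.

Section Regions.
Variable R : realType.
Local Open Scope ring_scope.

(* Clock regions, restricted to one clock: guards do not compare clocks. *)
Definition same_region (a b : R) :=
  forall c : nat, (a < c%:R) = (b < c%:R) /\ (a == c%:R) = (b == c%:R).

Lemma guard_sat_region m (v v' : 'I_m -> R) g :
  (forall x, same_region (v x) (v' x)) -> guard_sat v g = guard_sat v' g.
Proof.
move=> vv'; elim: g => //= [x r c|g ->|g -> g' ->|g -> g' ->] //.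
have [lt eq] := vv' x c.
case: r => /=.
- exact: lt.
- by rewrite !le_eqVlt lt eq.
- exact: eq.
- by rewrite !leNgt lt.
- by rewrite !ltNge !le_eqVlt lt eq.
Qed.

Lemma cmp_nat_between (a : R) c d : c%:R < a < c.+1%:R ->
  (a < d%:R) = (c < d)%N /\ (a == d%:R) = false.
Proof.
move=> /andP[ca ac]; case: (ltnP c d) => cd.
  have ad : a < d%:R by apply: lt_le_trans ac _; rewrite ler_nat.
  by rewrite ad lt_eqF.
have da : d%:R < a by apply: le_lt_trans ca; rewrite ler_nat.
by rewrite gt_eqF // ltNge ltW.
Qed.

Lemma same_region_between (a b : R) c :
  c%:R < a < c.+1%:R -> c%:R < b < c.+1%:R -> same_region a b.
Proof.
move=> ca cb d.
by have [-> ->] := cmp_nat_between d ca; have [-> ->] := cmp_nat_between d cb.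
Qed.

Lemma run_step_region k (A : tba k) (w w' : timed_word R k) e i :
  (w i).2 = (w' i).2 ->
  (forall x, same_region (clock w e i x) (clock w' e i x)) ->
  run_step (A := A) w e i <-> run_step (A := A) w' e i.
Proof. by move=> ll /guard_sat_region gg; rewrite /run_step ll gg. Qed.

Lemma clock_region_moved_event k n m (w w' : timed_word R k)
    (e : nat -> transition k n m) s p x :
  (forall q, q != s -> event_time w q = event_time w' q) ->
  same_region (clock w e s x) (clock w' e s x) ->
  ((s < p)%N -> last_reset e p x = Some s ->
    same_region (event_time w p - event_time w s)
      (event_time w' p - event_time w' s)) ->
  same_region (clock w e p x) (clock w' e p x).
Proof.
move=> ww' reg_s reg_p; have [-> //|ps] := eqVneq p s.
move: reg_p; rewrite /clock /reset_time ww' //.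
case E: last_reset => [j|] //=; have [js|js] := eqVneq j s;
  last by rewrite (ww' j).
by rewrite js; apply=> //; rewrite -js (last_reset_lt E).
Qed.

End Regions.

(** * Languages determined by unit gaps *)

Section GridWords.
Variables (R : realType) (k : nat) (a : 'I_k) (u : timed_word R k).
Local Open Scope ring_scope.

(* The event [p < L] has letter [a] and occurs at time [f p / M.+1]. *)
Definition grid_word (M L : nat) (f : nat -> nat) : timed_word R k := fun p =>
  if (p < L)%N then
    (((f p - (if p is q.+1 then f q else 0))%N.-1.+1%:R / M.+1%:R)%:pos, a)
  else u (p - L)%N.

Definition grid_increasing (L : nat) (f : nat -> nat) : Prop :=
  (0 < f 0)%N /\ forall q, (q.+1 < L)%N -> (f q < f q.+1)%N.

Lemma grid_word_label M L f p : (p < L)%N -> (grid_word M L f p).2 = a.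
Proof. by rewrite /grid_word => ->. Qed.

Lemma grid_word_suffix M L f p : grid_word M L f (L + p)%N = u p.
Proof. by rewrite /grid_word ltnNge leq_addr addKn. Qed.

Lemma eq_grid_word M L f g p : (forall q, (q <= p)%N -> f q = g q) ->
  grid_word M L f p = grid_word M L g p.
Proof.
by rewrite /grid_word; case: p => [|p] fg; rewrite fg // fg.
Qed.

Lemma grid_word_time M L f p : grid_increasing L f -> (p < L)%N ->
  event_time (grid_word M L f) p = (f p)%:R / M.+1%:R.
Proof.
move=> [f0 fS]; elim: p => [|p IHp] pL.
  by rewrite event_time0 /grid_word pL /= subn0 prednK.
have lt_f := fS p pL; rewrite event_timeS (IHp (ltnW pL)) /grid_word pL /=.
by rewrite prednK ?subn_gt0 // -mulrDl -natrD subnKC // ltnW.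
Qed.

Lemma eq_grid_word_time M L f g p : (0 < L)%N ->
  grid_increasing L f -> grid_increasing L g -> f L.-1 = g L.-1 -> (L <= p)%N ->
  event_time (grid_word M L f) p = event_time (grid_word M L g) p.
Proof.
case: L => // L _ finc ginc fg Lp; rewrite -(subnKC Lp).
elim: (p - L.+1)%N => [|d IHd]; last first.
  by rewrite addnS !(event_timeS _ (L.+1 + d)) IHd -addnS !grid_word_suffix.
have next_u h : grid_word M L.+1 h L.+1 = u 0%N by rewrite /grid_word ltnn subnn.
by rewrite addn0 !event_timeS !next_u !grid_word_time //; move: fg => /= ->.
Qed.

Lemma eq_grid_unit M (x y : nat) :
  (x%:R / M.+1%:R == y%:R / M.+1%:R + 1 :> R) = (x == (y + M.+1)%N).
Proof.
have M0 : M.+1%:R != 0 :> R by rewrite pnatr_eq0.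
by rewrite -(inj_eq (mulIf M0)) mulrDl !divfK // mul1r -natrD eqr_nat.
Qed.

Lemma grid_between M (c x y : nat) : (c * M.+1 + y < x < c.+1 * M.+1 + y)%N ->
  c%:R < (x%:R / M.+1%:R - y%:R / M.+1%:R : R) < c.+1%:R.
Proof.
have M0 : 0 < M.+1%:R :> R by rewrite ltr0n.
move=> /andP[lo up]; rewrite -mulrBl; apply/andP; split.
  by rewrite ltr_pdivlMr // ltrBrDr -natrM -natrD ltr_nat.
by rewrite ltr_pdivrMr // ltrBlDr -natrM -natrD ltr_nat.
Qed.

Lemma grid_region M (c x x' y y' : nat) :
  (c * M.+1 + y < x < c.+1 * M.+1 + y)%N ->
  (c * M.+1 + y' < x' < c.+1 * M.+1 + y')%N ->
  same_region (x%:R / M.+1%:R - y%:R / M.+1%:R : R)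
    (x'%:R / M.+1%:R - y'%:R / M.+1%:R).
Proof. by move=> /grid_between h /grid_between; exact: same_region_between h. Qed.

Section GappedWords.
Variable N : nat.

Definition denom_pred := (N + N + 2)%N.
Definition block_length := (N + N).+1.

(* Numerators over [denom_pred.+1]: [N] events at even positions of the first time
   unit, [N] events at odd positions of the second one, and a last event which
   absorbs the shift, made in [gapped i], of the event [N + i] to exactly one
   time unit after the event [i]. *)
Definition gapless (p : nat) : nat :=
  if (p < N)%N then (p + p + 2)%N else (denom_pred.+1 + ((p - N) + (p - N) + 3))%N.

Definition gapped (i p : nat) : nat :=
  if p == (N + i)%N then (denom_pred.+1 + (i + i + 2))%N else gapless p.

Definition gapless_word := grid_word denom_pred block_length gapless.
Definition gapped_word i := grid_word denom_pred block_length (gapped i).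

Lemma gapless_increasing : grid_increasing block_length gapless.
Proof.
split; first by rewrite /gapless; case: ifP; lia.
by move=> q; rewrite /gapless /denom_pred /block_length; do ![case: ifP => ?]; lia.
Qed.

Lemma gapped_increasing i : (i < N)%N -> grid_increasing block_length (gapped i).
Proof.
move=> iN; rewrite /gapped /gapless /denom_pred /block_length; split=> [|q].
  by do ![case: ifP => ?]; lia.
by do ![case: ifP => ?]; lia.
Qed.

Lemma gapless_word_time p : (p < block_length)%N ->
  event_time gapless_word p = (gapless p)%:R / denom_pred.+1%:R.
Proof. exact/grid_word_time/gapless_increasing. Qed.

Lemma gapped_word_time i p : (i < N)%N -> (p < block_length)%N ->
  event_time (gapped_word i) p = (gapped i p)%:R / denom_pred.+1%:R.
Proof. by move=> iN; exact/grid_word_time/gapped_increasing. Qed.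

Lemma gapped_word_label i p : (gapless_word p).2 = (gapped_word i p).2.
Proof. by rewrite /gapped_word /gapless_word /grid_word; case: ifP. Qed.

Lemma gapped_word_time_other i p : (i < N)%N -> p != (N + i)%N ->
  event_time gapless_word p = event_time (gapped_word i) p.
Proof.
move=> iN pNi; have [pL|Lp] := ltnP p block_length.
  by rewrite gapless_word_time // gapped_word_time // /gapped (negPf pNi).
apply: eq_grid_word_time => //; first exact: gapless_increasing.
  exact: gapped_increasing.
by rewrite /gapped ifN // /block_length; lia.
Qed.

(* Before the shift, no event is at distance 1 of the event [N + i]; the shift
   only changes the region of its distance to the event [i]. *)
Lemma gapped_event_region n m (e : nat -> transition k n m) i x : (i < N)%N ->
  last_reset e N x <> Some i ->
  same_region (clock gapless_word e (N + i) x)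
    (clock (gapped_word i) e (N + i) x).
Proof.
move=> iN not_i.
have NiL : (N + i < block_length)%N by rewrite /block_length; lia.
rewrite /clock /reset_time gapless_word_time // gapped_word_time //.
have -> : gapless (N + i) = (denom_pred.+1 + (i + i + 3))%N.
  by rewrite /gapless ifN ?addKn //; lia.
have -> : gapped i (N + i) = (denom_pred.+1 + (i + i + 2))%N by rewrite /gapped eqxx.
case E: last_reset => [j|] /=; last first.
  have -> : (0 : R) = 0%:R / denom_pred.+1%:R by rewrite mul0r.
  by apply: (@grid_region _ 1); rewrite /denom_pred; lia.
have jNi := last_reset_lt E.
rewrite -gapped_word_time_other //; last by rewrite ltn_eqF.
rewrite gapless_word_time ?(ltn_trans jNi) // /gapless; case: ltnP => jN.
  have /eqP ji : j != i.
    apply/eqP => ji; apply: not_i; rewrite -ji.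
    by apply: last_reset_le E _ => //; lia.
  by case: (ltnP j i) => ?; [apply: (@grid_region _ 1)|apply: (@grid_region _ 0)];
    rewrite /denom_pred; lia.
by apply: (@grid_region _ 0); rewrite /denom_pred; lia.
Qed.

Definition forgets n m (e : nat -> transition k n m) t i : Prop :=
  forall x, last_reset e t x <> Some i.

Lemma gapped_run_step (A : tba k) e i p : (i < N)%N -> forgets e N i ->
  ((block_length <= p)%N -> forgets e block_length (N + i)%N) ->
  run_step (A := A) gapless_word e p <-> run_step (A := A) (gapped_word i) e p.
Proof.
move=> iN forgets_i forgets_Ni; apply: run_step_region => [|x].
  exact: gapped_word_label.
apply: (@clock_region_moved_event _ _ _ _ _ _ _ (N + i)) => [q||Nip reset_p].
- exact: gapped_word_time_other.
- exact: gapped_event_region.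
have [pL|Lp] := ltnP p block_length; last first.
  case: (forgets_Ni Lp x); apply: last_reset_le reset_p _ => //.
  by rewrite /block_length; lia.
rewrite -(gapped_word_time_other iN); last by rewrite gtn_eqF.
rewrite !gapless_word_time ?gapped_word_time ?(ltn_trans Nip) //.
by apply: (@grid_region _ 0); move: pL;
  rewrite /gapped ?eqxx /gapless !ifN /denom_pred /block_length; lia.
Qed.

Lemma gapped_run_step_prefix (A : tba k) e i p : (p < N)%N ->
  run_step (A := A) gapless_word e p <-> run_step (A := A) (gapped_word i) e p.
Proof.
move=> pN; apply: eq_run_step => q qp.
by apply: eq_grid_word => r rq; rewrite /gapped ifN //; lia.
Qed.

End GappedWords.
End GridWords.

Lemma exists_unremembered m N (f g : 'I_m -> option nat) : (m + m < N)%N ->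
  exists2 i, (i < N)%N & forall x, f x <> Some i /\ g x <> Some (N + i)%N.
Proof.
move=> mN; pose s := [seq odflt N (f x) | x <- enum 'I_m] ++
  [seq (odflt N (g x) - N)%N | x <- enum 'I_m].
have size_s : (size s < N)%N by rewrite /s size_cat 2!size_map size_enum_ord.
have /allPn[i] : ~~ all (mem s) (iota 0 N).
  apply: contraL size_s => /allP sub; rewrite -leqNgt -{1}(size_iota 0 N).
  exact: uniq_leq_size (iota_uniq 0 N) sub.
rewrite mem_iota /= add0n => iN;
  rewrite mem_cat negb_or => /andP[/negP fi /negP gi].
exists i => // x; split=> e; [apply: fi|apply: gi].
  by apply/mapP; exists x; rewrite ?mem_enum ?e.
by apply/mapP; exists x; rewrite ?mem_enum ?e //= addKn.
Qed.

Section UnitGap.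
Variables (R : realType) (k : nat) (a : 'I_k) (u : timed_word R k).
Variable S : set (timed_word R k).
Local Open Scope ring_scope.

Definition detects_unit_gaps : Prop := forall (w : timed_word R k) (L : nat),
  (forall p, (p < L)%N -> (w p).2 = a) -> (forall p, w (L + p)%N = u p) ->
  S w <-> exists p q, (p < q < L)%N /\ event_time w q = event_time w p + 1.

Hypothesis S_gaps : detects_unit_gaps.

Notation gapless_word := (gapless_word a u).
Notation gapped_word := (gapped_word a u).

Lemma mem_grid_word M L f : S (grid_word a u M L f) <->
  exists p q, (p < q < L)%N /\
    event_time (grid_word a u M L f) q = event_time (grid_word a u M L f) p + 1.
Proof.
by apply: S_gaps => p; [exact: grid_word_label|exact: grid_word_suffix].
Qed.

Lemma gapless_word_notin N : ~ S (gapless_word N).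
Proof.
move=> /mem_grid_word[p [q [/andP[pq qL]]]].
rewrite -/(gapless_word N) !gapless_word_time ?(ltn_trans pq) // => /eqP;
  rewrite eq_grid_unit.
by rewrite /gapless /denom_pred; do ![case: ifP => ?]; lia.
Qed.

Lemma gapped_word_in N i : (i < N)%N -> S (gapped_word N i).
Proof.
move=> iN; have [iL NiL] : (i < block_length N)%N /\ (N + i < block_length N)%N.
  by rewrite /block_length; lia.
apply/mem_grid_word; exists i, (N + i)%N; split; first by rewrite NiL; lia.
have := gapped_word_time a u iN NiL; rewrite /gapped_word => ->.
have := gapped_word_time a u iN iL; rewrite /gapped_word => ->.
apply/eqP; rewrite eq_grid_unit /gapped eqxx ifN /gapless ?iN;
  first by apply/eqP; lia.
by lia.
Qed.

Lemma exists_forgotten m n N (e f : nat -> transition k n m) t t' :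
  (m + m < N)%N ->
  exists2 i, (i < N)%N & forgets e t i /\ forgets f t' (N + i).
Proof.
move=> mN; have [i iN hi] :=
  exists_unremembered (last_reset e t) (last_reset f t') mN.
by exists i => //; split=> x; have [] := hi x.
Qed.

Lemma lang_neq_compl_unit_gaps (B : tba k) : lang B <> ~` S.
Proof.
move=> eB; set N := (nclocks B + nclocks B).+1.
have : lang B (gapless_word N) by rewrite eB; exact: gapless_word_notin.
move=> /langP[e [e0 he acc]].
have [i iN [fi fNi]] := exists_forgotten e e N (block_length N) (ltnSn _).
have : lang B (gapped_word N i).
  apply/langP; exists e; split=> [//|p|//].
  by apply/(gapped_run_step _ _ iN fi (fun=> fNi)); exact: he.
by rewrite eB; apply; exact: gapped_word_in.
Qed.

Section Deterministic.
Variable D : tba k.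
Hypotheses (detD : deterministic R D) (lang_D : lang D = S).

Let N := (nclocks D + nclocks D).+1.
Let L := block_length N.

Lemma gapped_runs : exists e : nat -> nat -> transition k (nstates D) (nclocks D),
  forall i, (i < N)%N -> accepting_run (A := D) (gapped_word N i) (e i).
Proof.
suff /choice[e he] : forall i, exists f, (i < N)%N ->
    accepting_run (A := D) (gapped_word N i) f by exists e.
move=> i; have [iN|_] := ltnP i N.
  by have := gapped_word_in iN; rewrite -lang_D => /langP[f]; exists f.
have := @gapped_word_in N 0 isT; rewrite -lang_D => /langP[f _].
by exists f.
Qed.

Variable e : nat -> nat -> transition k (nstates D) (nclocks D).
Hypothesis accepting_e :
  forall i, (i < N)%N -> accepting_run (A := D) (gapped_word N i) (e i).

Lemma gapped_runs_agree i j : (i < N)%N -> (j < N)%N ->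
  forall p, (p < N)%N -> e i p = e j p.
Proof.
move=> iN jN; have [i0 ei _] := accepting_e iN; have [j0 ej _] := accepting_e jN.
apply: (deterministic_run (w := gapless_word N) detD i0 j0) => q qN.
  by apply/(gapped_run_step_prefix _ _ _ _ qN); exact: ei.
by apply/(gapped_run_step_prefix _ _ _ _ qN); exact: ej.
Qed.

Lemma forgetting_gapped_run i p : (i < N)%N -> forgets (e 0%N) N i ->
  ((L <= p)%N -> forgets (e i) L (N + i)) ->
  run_step (A := D) (gapless_word N) (e i) p.
Proof.
move=> iN fi fL; have [_ /(_ p) ei _] := accepting_e iN.
apply/(gapped_run_step _ _ iN _ fL); last exact: ei.
by move=> x; rewrite (eq_last_reset x (gapped_runs_agree iN (ltn0Sn _))).
Qed.

End Deterministic.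

(* The runs on the words with a unit gap at [i] agree, on the first half by
   determinism and, for those [i] which are not remembered by a clock, on the
   second half because they also are runs on the word without unit gaps. *)
Lemma deterministic_neq_unit_gaps (D : tba k) : deterministic R D -> lang D <> S.
Proof.
move=> detD lang_D; set N := (nclocks D + nclocks D).+1; set L := block_length N.
have [e he] := gapped_runs lang_D.
have [j jN [fj _]] := exists_forgotten (e 0%N) (e 0%N) N N (ltnSn _).
have [i iN [fi fNi]] := exists_forgotten (e 0%N) (e j) N L (ltnSn _).
have agree p : (p < L)%N -> e i p = e j p.
  have [i0 _ _] := he i iN; have [j0 _ _] := he j jN.
  by apply: (deterministic_run (w := gapless_word N) detD i0 j0) => q qL;
    apply: (forgetting_gapped_run detD he) => // /(leq_trans qL); rewrite ltnn.
have [e0 ei acc] := he i iN.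
apply: (@gapless_word_notin N); rewrite -lang_D; apply/langP; exists (e i).
split=> [//|p|//]; apply: (forgetting_gapped_run detD he) => // _ x.
by rewrite (eq_last_reset x agree).
Qed.

End UnitGap.

(** * Well-formed words and their detector *)

(* Letters are cells, or [None] for the blank letter. *)
Record format (A : Type) := Format {
  may_follow : rel A;
  may_copy : rel A;
  is_fresh : pred A;
  is_first : pred A;
  at_deadline : pred A;
  off_deadline : pred A;
  is_signal : pred A }.

Definition cell_is (A : Type) (P : pred A) (l : option A) : bool :=
  oapp P false l.

Definition follows (A : Type) (F : format A) (l l' : option A) : bool :=
  match l, l' with
  | None, None => true
  | None, Some d => is_first F d
  | Some _, None => false
  | Some c, Some d => may_follow F c d
  end.

Section WellFormed.
Variables (A : Type) (F : format A) (R : realType) (n : nat).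
Implicit Types (T : nat -> R) (l : nat -> option A).

(* A block of blanks, no two of them at distance 1, precedes cells such that each
   of them has a copy exactly one time unit later, all the cells between the
   copies of two consecutive ones being fresh. The deadline comes [n.+1] time
   units after the first cell. *)
Record well_formed T l : Prop := WellFormed {
  wf_start : follows F None (l 0);
  wf_next : forall p, follows F (l p) (l p.+1);
  wf_copy : forall p c, l p = Some c ->
    exists q, [/\ (p < q)%N, T q = T p + 1 & cell_is (may_copy F c) (l q)]%R;
  wf_fresh : forall p q, p.+1 < q -> isSome (l p) ->
    (T p + 1 < T q -> T q < T p.+1 + 1 -> cell_is (is_fresh F) (l q))%R;
  wf_blank : forall p q, p < q -> l p = None -> l q = None -> (T q <> T p + 1)%R;
  wf_at_deadline : forall p q, p < q -> cell_is (is_first F) (l p) ->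
    cell_is (at_deadline F) (l q) -> (T q = T p + n.+1%:R)%R;
  wf_off_deadline : forall p q, p < q -> cell_is (is_first F) (l p) ->
    cell_is (off_deadline F) (l q) -> (T q <> T p + n.+1%:R)%R;
  wf_first : forall p, cell_is (is_first F) (l p) -> (T p.+1 = T p + 1)%R;
  wf_signal : infinitely_often (fun p => cell_is (is_signal F) (l p)) }.

Lemma well_formed_drop T l k : well_formed T l -> follows F None (l k) ->
  well_formed (fun p => T (k + p)) (fun p => l (k + p)).
Proof.
move=> wf start; split.
- by rewrite addn0.
- by move=> p; rewrite addnS; exact: wf_next wf _.
- move=> p c /(wf_copy wf)[q [pq Tq cq]].
  by exists (q - k); rewrite subnKC; [split=> //|]; lia.
- by move=> p q pq lp; rewrite addnS => *; apply: (wf_fresh wf) lp _ _ => //; lia.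
- by move=> p q pq; apply: (wf_blank wf); lia.
- by move=> p q pq; apply: (wf_at_deadline wf); lia.
- by move=> p q pq; apply: (wf_off_deadline wf); lia.
- by move=> p; rewrite addnS; exact: wf_first wf _.
- move=> N; have [p Np sp] := wf_signal wf (k + N).
  by exists (p - k); [|rewrite subnKC //]; lia.
Qed.

Lemma well_formed_cells T l : well_formed T l ->
  exists k c, well_formed (fun p => T (k + p)) (fun p => Some (c p)).
Proof.
move=> wf; have ex_cell : exists p, isSome (l p).
  by have [p _] := wf_signal wf 0; case E: (l p) => // _; exists p; rewrite E.
case: (ex_minnP ex_cell) => k lk min_k.
have start : follows F None (l k).
  case: k lk min_k => [|k] lk min_k; first exact: wf_start wf.
  have := wf_next wf k; case E: (l k) => //.
  by have := min_k k; rewrite E ltnn => /(_ isT).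
have cells p : isSome (l (k + p)).
  elim: p => [|p IHp]; first by rewrite addn0.
  by have := wf_next wf (k + p); rewrite addnS; case: (l _) IHp => // c _;
    case: (l _).
have cell p : exists c, l (k + p) = Some c.
  by case: (l _) (cells p) => // c _; exists c.
have [c lE] := choice cell.
exists k, c; rewrite (_ : (fun p => Some (c p)) = fun p => l (k + p)).
  exact: well_formed_drop.
by apply/funext => p; rewrite lE.
Qed.

Lemma well_formed_cons T l : l 0 = None ->
  (forall p, l p.+1 = None -> (T p.+1 <> T 0 + 1)%R) ->
  well_formed (fun p => T p.+1) (fun p => l p.+1) -> well_formed T l.
Proof.
move=> l0 gap wf; split; rewrite ?l0 //.
- by case=> [|p]; [rewrite l0; exact: wf_start wf|exact: wf_next wf p].
- case=> [|p] c; first by rewrite l0.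
  by move=> /(wf_copy wf)[q [pq Tq cq]]; exists q.+1.
- by case=> [|p] [|q] //; rewrite ?l0 //; exact: (wf_fresh wf (p := p) (q := q)).
- by case=> [|p] [|q] //;
    [move=> _ _; exact: gap|exact: (wf_blank wf (p := p) (q := q))].
- by case=> [|p] [|q] //; rewrite ?l0 //;
    exact: (wf_at_deadline wf (p := p) (q := q)).
- by case=> [|p] [|q] //; rewrite ?l0 //;
    exact: (wf_off_deadline wf (p := p) (q := q)).
- by case=> [|p]; rewrite ?l0 //; exact: (wf_first wf (p := p)).
- by move=> N; have [p Np sp] := wf_signal wf N; exists p.+1 => //; exact: leqW.
Qed.

Lemma well_formed_prepend T l c L :
  (forall p, p < L -> l p = None) -> (forall p, l (L + p) = Some (c p)) ->
  (forall p q, p < q < L -> (T q <> T p + 1)%R) ->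
  well_formed (fun p => T (L + p)) (fun p => Some (c p)) -> well_formed T l.
Proof.
elim: L T l => [|L IHL] T l blank cell gap wf.
  by rewrite (_ : l = fun p => Some (c p)) //; apply/funext.
apply: well_formed_cons => [|p lp|]; first exact: blank.
  apply: gap; rewrite /= ltnS ltnNge; apply/negP => Lp.
  by have := cell (p - L); rewrite addSn subnKC // lp.
apply: IHL => // [p pL|p q pqL]; first exact: blank.
exact: gap.
Qed.

End WellFormed.

Inductive dstate (A : Type) :=
| Scanning | Violated | BetweenCopies | AfterBlank | AfterFirst | Unsignaled
| AfterLetter of option A | Uncopied of A.
Arguments Scanning {A}.
Arguments Violated {A}.
Arguments BetweenCopies {A}.
Arguments AfterBlank {A}.
Arguments AfterFirst {A}.
Arguments Unsignaled {A}.

Section DState.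
Variable A : Type.

Definition dstate_enc (q : dstate A) : 'I_6 + (option A + A) :=
  match q with
  | Scanning => inl (inord 0)
  | Violated => inl (inord 1)
  | BetweenCopies => inl (inord 2)
  | AfterBlank => inl (inord 3)
  | AfterFirst => inl (inord 4)
  | Unsignaled => inl (inord 5)
  | AfterLetter l => inr (inl l)
  | Uncopied c => inr (inr c)
  end.

Definition dstate_dec (z : 'I_6 + (option A + A)) : dstate A :=
  match z with
  | inl i =>
      nth Scanning [:: Scanning; Violated; BetweenCopies; AfterBlank; AfterFirst;
                       Unsignaled] i
  | inr (inl l) => AfterLetter l
  | inr (inr c) => Uncopied c
  end.

Lemma dstate_encK : cancel dstate_enc dstate_dec.
Proof. by case=> //=; rewrite inordK. Qed.

End DState.

HB.instance Definition _ (A : finType) :=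
  Finite.copy (dstate A) (can_type (@dstate_encK A)).

Definition clk_x : 'I_2 := ord0.
Definition clk_y : 'I_2 := ord_max.

Variant check :=
| Anytime | InCopyGap | NotAtUnit | AtUnit | NotAtDeadline | AtDeadline.

Definition check_code (g : check) : nat :=
  match g with
  | Anytime => 0
  | InCopyGap => 1
  | NotAtUnit => 2
  | AtUnit => 3
  | NotAtDeadline => 4
  | AtDeadline => 5
  end.

Lemma check_code_inj : injective check_code.
Proof. by case; case. Qed.

HB.instance Definition _ := Equality.copy check (inj_type check_code_inj).

Definition check_guard (n : nat) (g : check) : guard 2 :=
  match g with
  | Anytime => GTrue
  | InCopyGap => GAnd (GCmp clk_x CGt 1) (GCmp clk_y CLt 1)
  | NotAtUnit => GNot (GCmp clk_x CEq 1)
  | AtUnit => GCmp clk_x CEq 1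
  | NotAtDeadline => GNot (GCmp clk_x CEq n.+1)
  | AtDeadline => GCmp clk_x CEq n.+1
  end.

Definition check_sat (R : realType) (n : nat) (g : check) (x y : R) : bool :=
  (match g with
  | Anytime => true
  | InCopyGap => (1 < x) && (y < 1)
  | NotAtUnit => x != 1
  | AtUnit => x == 1
  | NotAtDeadline => x != n.+1%:R
  | AtDeadline => x == n.+1%:R
  end)%R.

Lemma check_guardP (R : realType) n g (v : 'I_2 -> R) :
  guard_sat v (check_guard n g) = check_sat n g (v clk_x) (v clk_y).
Proof. by case: g. Qed.

Definition reset_set (r : option 'I_2) : {set 'I_2} :=
  if r is Some x then [set x]%SET else finset.set0.

Lemma mem_reset_set r x : (x \in reset_set r) = (r == Some x).
Proof. by case: r => [y|]; rewrite inE // eq_sym. Qed.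

Section Detector.
Variables (A : finType) (F : format A).

Definition dmove := (dstate A * check * option 'I_2)%type.

(* Every way of not being well-formed is guessed from [Scanning]; the factors
   [(_ : bool)] of [nseq] are side conditions. *)
Definition moves (q : dstate A) (l : option A) : seq dmove :=
  match q with
  | Scanning =>
      [:: (Scanning, Anytime, None);
          (Unsignaled, Anytime, None);
          (AfterLetter l, Anytime, Some clk_x);
          (if l is Some c then Uncopied c else AfterBlank, Anytime, Some clk_x)]
      ++ nseq (cell_is (is_first F) l) (AfterFirst, Anytime, Some clk_x)
  | Violated => [:: (Violated, Anytime, None)]
  | BetweenCopies =>
      (BetweenCopies, Anytime, None)
      :: nseq (~~ cell_is (is_fresh F) l) (Violated, InCopyGap, None)
  | AfterBlank =>
      (AfterBlank, Anytime, None)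
      :: nseq (~~ l) (Violated, AtUnit, None)
  | AfterFirst =>
      (AfterFirst, Anytime, None)
      :: nseq (cell_is (at_deadline F) l) (Violated, NotAtDeadline, None)
      ++ nseq (cell_is (off_deadline F) l) (Violated, AtDeadline, None)
  | Unsignaled => nseq (~~ cell_is (is_signal F) l) (Unsignaled, Anytime, None)
  | AfterLetter l0 =>
      nseq (~~ follows F l0 l) (Violated, Anytime, None)
      ++ nseq l0 (BetweenCopies, Anytime, Some clk_y)
      ++ nseq (cell_is (is_first F) l0) (Violated, NotAtUnit, None)
  | Uncopied c =>
      (Uncopied c, NotAtUnit, None)
      :: nseq (~~ cell_is (may_copy F c) l) (Violated, AtUnit, None)
  end.

(* Before the first event, [AfterLetter None] stands for an empty prefix. *)
Definition dinitial (q : dstate A) : bool :=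
  (q == Scanning) || (q == AfterLetter None).

Definition daccepting (q : dstate A) : bool :=
  match q with Violated | Unsignaled | Uncopied _ => true | _ => false end.

Definition nletters : nat := #|{: option A}|.

Definition edge (n : nat) (d : dstate A * option A * dmove) :
    transition nletters #|{: dstate A}| 2 :=
  Transition (enum_rank d.1.1) (enum_rank d.1.2) (check_guard n d.2.1.2)
    (reset_set d.2.2) (enum_rank d.2.1.1).

Definition dmoves : seq (dstate A * option A * dmove) :=
  [seq (d, m) | d <- enum {: dstate A * option A}, m <- moves d.1 d.2].

Definition detector (n : nat) : tba nletters :=
  @TBA nletters #|{: dstate A}| 2
    [set i | dinitial (enum_val i)]%SET [set i | daccepting (enum_val i)]%SET
    [seq edge n d | d <- dmoves].

Lemma mem_dmoves q l m : ((q, l, m) \in dmoves) = (m \in moves q l).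
Proof.
apply/allpairsPdep/idP => [[[q' l'] [m' [_ mm' [-> -> ->]]]] //|mm].
by exists (q, l), m; rewrite mem_enum.
Qed.

#[local] Arguments CodeSeq.code : simpl never.
#[local] Hint Resolve computable_const computable_succ : computable.
#[local] Hint Resolve computable_code_cons : computable.

Lemma computable_guard_code g :
  computable (fun n => guard_code (check_guard n g)).
Proof. by case: g => /=; auto 10 with computable. Qed.

Lemma computable_transition_code d :
  computable (fun n => transition_code (edge n d)).
Proof.
have := computable_guard_code; rewrite /transition_code /=.
by auto 10 with computable.
Qed.

Lemma computable_detector :
  computable (fun n => tba_code (existT _ nletters (detector n))).
Proof.
have transitions : computable (fun n => CodeSeq.code
    (map (@transition_code _ _ _) [seq edge n d | d <- dmoves])).
  rewrite (_ : (fun n => _) = fun n => CodeSeq.code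
      [seq transition_code (edge n d) | d <- dmoves]).
    exact/computable_code_map/computable_transition_code.
  by apply/funext => n; rewrite -map_comp.
by rewrite /tba_code /=; auto 10 with computable.
Qed.

End Detector.

Section DetectorRuns.
Variables (A : finType) (F : format A) (R : realType) (n : nat).
Variable w : timed_word R (nletters A).

Notation T := (event_time w).

Definition letter (i : nat) : option A := enum_val (w i).2.

(* A state, with the times of the last resets of the clocks [x] and [y]. *)
Definition dconf := (dstate A * R * R)%type.

Definition dsat (i : nat) (g : check) (s : dconf) : bool :=
  check_sat n g (T i - s.1.2)%R (T i - s.2)%R.

Definition fire (i : nat) (m : dmove A) (s : dconf) : dconf :=
  (m.1.1, if m.2 == Some clk_x then T i else s.1.2,
   if m.2 == Some clk_y then T i else s.2).

Definition dstep (i : nat) (s s' : dconf) : Prop :=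
  exists m, [/\ m \in moves F s.1.1 (letter i), dsat i m.1.2 s & s' = fire i m s].

Definition accepted_from (i : nat) (s : dconf) : Prop :=
  exists c : nat -> dconf, [/\ c 0 = s, forall j, dstep (i + j) (c j) (c j.+1) &
    infinitely_often (fun j => daccepting (c j).1.1)].

Lemma detector_langP : lang (detector F n) w <->
  exists2 q, dinitial q & accepted_from 0 (q, 0%R, 0%R).
Proof.
rewrite langP; split=> [[e [e0 he acc]]|[q q0 [c [c0 hc acc]]]].
  have decode i : exists d, d \in dmoves F /\ e i = edge n d.
    by have [/mapP[d dm ->] _ _ _] := he i; exists d.
  have [d /all_and2[dm eE]] := choice decode.
  have sourceE i : source (e i) = enum_rank (d i).1.1 by rewrite eE.
  have labelE i : (d i).1.2 = letter i.
    by have [_ _ + _] := he i; rewrite eE /letter => <-; rewrite enum_rankK.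
  exists (d 0%N).1.1; first by move: e0; rewrite inE sourceE enum_rankK.
  exists (fun i => ((d i).1.1, reset_time w e i clk_x, reset_time w e i clk_y)).
  split=> // [i|N]; last first.
    by have [i Ni] := acc N; rewrite inE sourceE enum_rankK => ai; exists i.
  have [_ target_e _ guard_e] := he i; exists (d i).2; split.
  - by rewrite -labelE -mem_dmoves -!surjective_pairing.
  - by move: guard_e; rewrite eE check_guardP.
  - have -> : (d i.+1).1.1 = (d i).2.1.1.
      by apply: enum_rank_inj; rewrite -sourceE -target_e eE.
    by rewrite /fire /= -!mem_reset_set !reset_timeS eE.
have [m hm] := choice hc.
have qE i : (c i.+1).1.1 = (m i).1.1 by have [_ _ ->] := hm i.
pose e i := edge n ((c i).1.1, letter i, m i).
have resetE i :
    reset_time w e i clk_x = (c i).1.2 /\ reset_time w e i clk_y = (c i).2.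
  elim: i => [|i [IHx IHy]]; first by rewrite c0.
  by have [_ _ ->] := hm i; rewrite !reset_timeS !mem_reset_set IHx IHy.
exists e; split=> [|i|N]; first by rewrite inE enum_rankK c0.
  have [mm gm _] := hm i; split.
  - by apply/mapP; exists ((c i).1.1, letter i, m i); rewrite ?mem_dmoves.
  - by rewrite /= qE.
  - by rewrite /= enum_valK.
  - by rewrite check_guardP /clock; have [-> ->] := resetE i.
by have [i Ni ai] := acc N; exists i; rewrite // inE enum_rankK.
Qed.

Lemma dstep_stay i q q' x y g : (q', g, None) \in moves F q (letter i) ->
  dsat i g (q, x, y) -> dstep i (q, x, y) (q', x, y).
Proof. by move=> mm gm; exists (q', g, None). Qed.

Lemma dstep_reset_x i q q' x y :
  (q', Anytime, Some clk_x) \in moves F q (letter i) ->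
  dstep i (q, x, y) (q', T i, y).
Proof. by move=> mm; exists (q', Anytime, Some clk_x). Qed.

Lemma dstep_reset_y i q q' x y :
  (q', Anytime, Some clk_y) \in moves F q (letter i) ->
  dstep i (q, x, y) (q', x, T i).
Proof. by move=> mm; exists (q', Anytime, Some clk_y). Qed.

Lemma accepted_step i s s' :
  dstep i s s' -> accepted_from i.+1 s' -> accepted_from i s.
Proof.
move=> ss' [c [c0 hc acc]]; exists (fun j => if j is j'.+1 then c j' else s);
  split=> //.
  by case=> [|j]; [rewrite addn0 c0|rewrite addnS -addSn].
by move=> N; have [j Nj aj] := acc N; exists j.+1; rewrite // leqW.
Qed.

Lemma accepted_loop i s : daccepting s.1.1 -> (forall j, i <= j -> dstep j s s) ->
  accepted_from i s.
Proof.
move=> acc hs; exists (fun=> s); split=> // [j|N]; last by exists N.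
exact/hs/leq_addr.
Qed.

Lemma accepted_wait i j s : i <= j -> (forall r, i <= r < j -> dstep r s s) ->
  accepted_from j s -> accepted_from i s.
Proof.
move=> /subnKC <-; elim: (j - i) => [|d IHd] hs; first by rewrite addn0.
rewrite addnS => acc; apply: IHd => [r /andP[ir rd]|].
  by apply: hs; rewrite ir addnS ltnW.
by apply: accepted_step acc; apply: hs; rewrite addnS leqnn leq_addr.
Qed.

Lemma accepted_violated i x y : accepted_from i (Violated, x, y).
Proof.
by apply: accepted_loop => // j _; apply: (@dstep_stay _ _ _ _ _ Anytime);
  rewrite ?inE.
Qed.

Lemma lang_scanned p s : dstep p (Scanning, 0%R, 0%R) s -> accepted_from p.+1 s ->
  lang (detector F n) w.
Proof.
move=> step acc; apply/detector_langP; exists Scanning;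
  first by rewrite /dinitial eqxx.
apply: (@accepted_wait _ p) => // [r _|]; last exact: accepted_step acc.
by apply: (@dstep_stay _ _ _ _ _ Anytime); rewrite // !inE eqxx.
Qed.

Lemma lang_violation q g0 g p r : p < r ->
  (q, Anytime, Some clk_x) \in moves F Scanning (letter p) ->
  (forall i y, p < i < r ->
    (q, g0, None) \in moves F q (letter i) /\ dsat i g0 (q, T p, y)) ->
  (Violated, g, None) \in moves F q (letter r) ->
  (forall y, dsat r g (q, T p, y)) -> lang (detector F n) w.
Proof.
move=> pr enter loop exit sat; apply: lang_scanned;
  first exact: dstep_reset_x enter.
apply: (accepted_wait pr) => [i pir|].
  by have [] := loop i 0%R pir; exact: dstep_stay.
by apply: accepted_step (accepted_violated _ _ _); exact: dstep_stay exit (sat _).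
Qed.

Lemma sub_time_eq i p (d : R) : (T i - T p == d)%R = (T i == T p + d)%R.
Proof. by rewrite subr_eq addrC. Qed.

Lemma lang_bad_start : ~~ follows F None (letter 0) -> lang (detector F n) w.
Proof.
move=> bad; apply/detector_langP; exists (AfterLetter None);
  first by rewrite /dinitial eqxx orbT.
apply: accepted_step (accepted_violated _ _ _).
by apply: (@dstep_stay _ _ _ _ _ Anytime); rewrite // mem_cat mem_nseq bad eqxx.
Qed.

Lemma lang_bad_next p :
  ~~ follows F (letter p) (letter p.+1) -> lang (detector F n) w.
Proof.
move=> bad.
apply: (@lang_violation (AfterLetter (letter p)) Anytime Anytime p p.+1) => //.
- by rewrite !inE eqxx !orbT.
- by move=> i y; lia.
- by rewrite mem_cat mem_nseq bad eqxx.
Qed.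

Lemma lang_uncopied p c : letter p = Some c ->
  (forall q, p < q -> T q = (T p + 1)%R ->
    ~~ cell_is (may_copy F c) (letter q)) ->
  lang (detector F n) w.
Proof.
move=> lp bad.
have enter : (Uncopied c, Anytime, Some clk_x) \in moves F Scanning (letter p).
  by rewrite lp !inE eqxx !orbT.
have loop i y : p < i -> T i <> (T p + 1)%R ->
    (Uncopied c, NotAtUnit, None) \in moves F (Uncopied c) (letter i) /\
    dsat i NotAtUnit (Uncopied c, T p, y).
  by move=> pi neq; rewrite inE eqxx /dsat /= sub_time_eq; split=> //; apply/eqP.
have [[r pr Tr]|no_r] := pselect (exists2 r, p < r & T r = (T p + 1)%R).
  apply: (lang_violation (g0 := NotAtUnit) (g := AtUnit) pr enter).
  - move=> i y /andP[pi ir].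
    by apply: loop pi _; rewrite -Tr => /event_time_inj; lia.
  - by rewrite inE mem_nseq bad // eqxx orbT.
  - by move=> y; rewrite /dsat /= sub_time_eq Tr.
apply: (lang_scanned (dstep_reset_x _ _ enter)); apply: accepted_loop => // i pi.
by have [] := loop i 0%R pi (fun Ti => no_r (ex_intro2 _ _ i pi Ti));
  exact: dstep_stay.
Qed.

Lemma lang_not_fresh p q :
  p.+1 < q -> letter p -> ~~ cell_is (is_fresh F) (letter q) ->
  (T p + 1 < T q)%R -> (T q < T p.+1 + 1)%R -> lang (detector F n) w.
Proof.
move=> pq lp bad lo up.
have enter :
    (AfterLetter (letter p), Anytime, Some clk_x) \in moves F Scanning (letter p).
  by rewrite !inE eqxx !orbT.
apply: (lang_scanned (dstep_reset_x _ _ enter)).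
apply: (@accepted_step _ _ (BetweenCopies, T p, T p.+1)).
  by apply: dstep_reset_y; rewrite !mem_cat !mem_nseq lp eqxx orbT.
apply: (accepted_wait pq) => [i _|].
  by apply: (@dstep_stay _ _ _ _ _ Anytime); rewrite // inE eqxx.
apply: accepted_step (accepted_violated _ _ _).
apply: (@dstep_stay _ _ _ _ _ InCopyGap);
  first by rewrite inE mem_nseq bad eqxx orbT.
by rewrite /dsat /= ltrBrDl ltrBlDl lo up.
Qed.

Lemma lang_bad_blank p q : p < q -> letter p = None -> letter q = None ->
  (T q = T p + 1)%R -> lang (detector F n) w.
Proof.
move=> pq lp lq bad; apply: (@lang_violation AfterBlank Anytime AtUnit p q) => //.
- by rewrite lp !inE eqxx !orbT.
- by move=> i y _; rewrite inE eqxx.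
- by rewrite lq inE mem_nseq eqxx orbT.
- by move=> y; rewrite /dsat /= sub_time_eq bad.
Qed.

Lemma lang_bad_deadline p q : p < q -> cell_is (is_first F) (letter p) ->
  cell_is (at_deadline F) (letter q) && (T q != T p + n.+1%:R)%R ||
  cell_is (off_deadline F) (letter q) && (T q == T p + n.+1%:R)%R ->
  lang (detector F n) w.
Proof.
move=> pq fp bad.
have enter : (AfterFirst, Anytime, Some clk_x) \in moves F Scanning (letter p).
  by rewrite mem_cat mem_nseq fp eqxx orbT.
have loop i y : p < i < q ->
    (AfterFirst, Anytime, None) \in moves F AfterFirst (letter i) /\
    dsat i Anytime (AfterFirst, T p, y).
  by rewrite inE eqxx.
case/orP: bad => /andP[lq Tq].
  apply: (lang_violation (g := NotAtDeadline) pq enter loop) => [|y].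
    by rewrite inE mem_cat mem_nseq lq eqxx orbT.
  by rewrite /dsat /= sub_time_eq.
apply: (lang_violation (g := AtDeadline) pq enter loop) => [|y].
  by rewrite inE mem_cat !mem_nseq lq eqxx !orbT.
by rewrite /dsat /= sub_time_eq.
Qed.

Lemma lang_bad_first p :
  cell_is (is_first F) (letter p) -> (T p.+1 <> T p + 1)%R ->
  lang (detector F n) w.
Proof.
move=> fp bad.
apply: (@lang_violation (AfterLetter (letter p)) Anytime NotAtUnit p p.+1) => //.
- by rewrite !inE eqxx !orbT.
- by move=> i y; lia.
- by rewrite !mem_cat !mem_nseq fp eqxx !orbT.
- by move=> y; rewrite /dsat /= sub_time_eq; apply/eqP.
Qed.

Lemma lang_unsignaled N :
  (forall p, N <= p -> ~~ cell_is (is_signal F) (letter p)) ->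
  lang (detector F n) w.
Proof.
move=> bad; apply: (@lang_scanned N (Unsignaled, 0%R, 0%R)).
  by apply: (@dstep_stay _ _ _ _ _ Anytime); rewrite // !inE eqxx !orbT.
apply: accepted_loop => // i Ni; apply: (@dstep_stay _ _ _ _ _ Anytime) => //.
by rewrite mem_nseq bad ?eqxx // ltnW.
Qed.

Lemma not_well_formed_lang : ~ well_formed F n T letter -> lang (detector F n) w.
Proof.
move=> nwf; apply: contrapT => no; apply: nwf; split.
- by apply: contrapT => /negP/lang_bad_start.
- by move=> p; apply: contrapT => /negP/lang_bad_next.
- move=> p c lp; apply: contrapT => no_copy;
    apply/no/(lang_uncopied lp) => q pq Tq.
  by apply/negP => cq; apply: no_copy; exists q.
- by move=> p q pq lp lo up; apply: contrapT => /negP nf;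
    apply/no/(lang_not_fresh pq lp nf).
- by move=> p q pq lp lq Tq; apply/no/(lang_bad_blank pq lp lq).
- move=> p q pq fp aq; apply: contrapT => /eqP Tq.
  by apply/no/(lang_bad_deadline pq fp); rewrite aq Tq.
- move=> p q pq fp oq /eqP Tq.
  by apply/no/(lang_bad_deadline pq fp); rewrite oq Tq orbT.
- by move=> p fp; apply: contrapT => /(lang_bad_first fp).
- move=> N; apply: contrapT => no_signal; apply/no/(@lang_unsignaled N) => p Np.
  by apply/negP => sp; apply: no_signal; exists p.
Qed.

Section Soundness.
Hypothesis wf : well_formed F n T letter.

Definition tracks (i : nat) (s : dconf) : Prop :=
  match s.1.1 with
  | Scanning | Unsignaled => True
  | Violated => False
  | BetweenCopies => exists p, [/\ p.+1 < i, letter p, s.1.2 = T p & s.2 = T p.+1]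
  | AfterBlank => exists p, [/\ p < i, letter p = None & s.1.2 = T p]
  | AfterFirst =>
      exists p, [/\ p < i, cell_is (is_first F) (letter p) & s.1.2 = T p]
  | AfterLetter l => if i is j.+1 then letter j = l /\ s.1.2 = T j else l = None
  | Uncopied c => exists p, [/\ p < i, letter p = Some c, s.1.2 = T p &
      forall r, p < r < i -> T r <> (T p + 1)%R]
  end.

Definition keeps_tracking (q : dstate A) : Prop := forall i x y m,
  tracks i (q, x, y) -> m \in moves F q (letter i) -> dsat i m.1.2 (q, x, y) ->
  tracks i.+1 (fire i m (q, x, y)).

Lemma scanning_keeps_tracking : keeps_tracking Scanning.
Proof.
move=> i x y m _; rewrite mem_cat !inE mem_nseq lt0b.
case/orP=> [/or4P[]/eqP->|/andP[fi /eqP->]] _ //=; last by exists i.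
by rewrite /fire /=; case E: (letter i) => [c|]; exists i; split=> // r; lia.
Qed.

Lemma between_keeps_tracking : keeps_tracking BetweenCopies.
Proof.
move=> i x y m [p [pi lp /= -> ->]]; rewrite inE mem_nseq lt0b.
case/orP=> [/eqP->|/andP[/negP nf /eqP->]] /=.
  by exists p; split=> //; exact: leqW.
rewrite /dsat /= ltrBrDl ltrBlDl => /andP[lo up].
by case: nf; exact: (wf_fresh wf pi lp lo up).
Qed.

Lemma after_blank_keeps_tracking : keeps_tracking AfterBlank.
Proof.
move=> i x y m [p [pi lp /= ->]]; rewrite inE mem_nseq lt0b.
case/orP=> [/eqP->|/andP[nl /eqP->]] /=.
  by exists p; split=> //; exact: leqW.
rewrite /dsat /= sub_time_eq => /eqP; apply: (wf_blank wf pi lp).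
by case: (letter i) nl.
Qed.

Lemma after_first_keeps_tracking : keeps_tracking AfterFirst.
Proof.
move=> i x y m [p [pi fp /= ->]]; rewrite inE mem_cat !mem_nseq !lt0b.
case/or3P=> [/eqP->|/andP[li /eqP->]|/andP[li /eqP->]] /=.
- by exists p; split=> //; exact: leqW.
- by rewrite /dsat /= sub_time_eq (wf_at_deadline wf pi fp li) eqxx.
- by rewrite /dsat /= sub_time_eq => /eqP; exact: (wf_off_deadline wf pi fp li).
Qed.

Lemma unsignaled_keeps_tracking : keeps_tracking Unsignaled.
Proof. by move=> i x y m _; rewrite mem_nseq => /andP[_ /eqP->]. Qed.

Lemma after_letter_keeps_tracking l : keeps_tracking (AfterLetter l).
Proof.
move=> i x y m tr; rewrite !mem_cat !mem_nseq !lt0b.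
case/or3P=> /andP[hl /eqP->] /=; rewrite /dsat /tracks /=.
- move=> _; move/negP: hl; apply; case: i tr => [->|j [<- _]];
    first exact: wf_start wf.
  exact: wf_next wf j.
- by case: i tr => [l0|j [lj xj]]; [rewrite l0 in hl|exists j; rewrite lj].
- case: i tr => [l0|j [lj /= ->]]; first by rewrite l0 in hl.
  by rewrite sub_time_eq (wf_first wf) ?lj ?eqxx.
Qed.

Lemma uncopied_keeps_tracking c : keeps_tracking (Uncopied c).
Proof.
move=> i x y m [p [pi lp /= -> no_copy]]; rewrite inE mem_nseq lt0b.
case/orP=> [/eqP->|/andP[/negP nc /eqP->]] /=;
  rewrite /dsat /= sub_time_eq => /eqP Ti.
  exists p; split=> // [|r /andP[pr]]; first exact: leqW.
  by rewrite ltnS leq_eqVlt => /orP[/eqP-> //|ri]; apply: no_copy; rewrite pr.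
have [r [_ Tr cr]] := wf_copy wf lp.
by case: nc; rewrite (_ : i = r) //; apply: (@event_time_inj _ _ w);
  rewrite Ti Tr.
Qed.

Lemma dstep_tracks i s s' : dstep i s s' -> tracks i s -> tracks i.+1 s'.
Proof.
case: s => [[q x] y] [m [mm gm ->]] tr.
have /(_ i x y m tr mm gm) // : keeps_tracking q.
case: q {mm gm tr} => [||||||l|c] //.
- exact: scanning_keeps_tracking.
- exact: between_keeps_tracking.
- exact: after_blank_keeps_tracking.
- exact: after_first_keeps_tracking.
- exact: unsignaled_keeps_tracking.
- exact: after_letter_keeps_tracking.
- exact: uncopied_keeps_tracking.
Qed.

Section Run.
Variable c : nat -> dconf.
Hypotheses (c0 : tracks 0 (c 0)) (hc : forall i, dstep i (c i) (c i.+1)).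

Lemma run_tracks i : tracks i (c i).
Proof. by elim: i => // i IHi; exact: dstep_tracks IHi. Qed.

Lemma run_never_violated i : (c i).1.1 <> Violated.
Proof. by have := run_tracks i; rewrite /tracks => + E; rewrite E. Qed.

Lemma unsignaled_stays i j : (c i).1.1 = Unsignaled -> i <= j ->
  (c j).1.1 = Unsignaled /\ ~~ cell_is (is_signal F) (letter j).
Proof.
move=> ci /subnKC <-.
have stays k : (c k).1.1 = Unsignaled ->
    (c k.+1).1.1 = Unsignaled /\ ~~ cell_is (is_signal F) (letter k).
  move=> ck; have [m [+ _ ->]] := hc k.
  by rewrite ck mem_nseq lt0b => /andP[ns /eqP->].
suff ij : (c (i + (j - i))).1.1 = Unsignaled by split; rewrite // (stays _ ij).2.
by elim: (j - i) => [|d IHd];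
  [rewrite addn0|rewrite addnS; exact: (stays _ IHd).1].
Qed.

Lemma run_never_unsignaled i : (c i).1.1 <> Unsignaled.
Proof.
move=> ci; have [p ip sp] := wf_signal wf i.
by have [_ /negP] := unsignaled_stays ci ip.
Qed.

Lemma uncopied_stays i j a : (c i).1.1 = Uncopied a -> i <= j -> c j = c i.
Proof.
move=> ci /subnKC <-; elim: (j - i) => [|d IHd]; first by rewrite addn0.
rewrite addnS -IHd; have := @run_never_violated (i + d).+1.
have [m [+ _ ->]] := hc (i + d); rewrite IHd ci inE mem_nseq.
case/orP=> [/eqP-> _|/andP[_ /eqP->] //].
by rewrite /fire /= -ci -!surjective_pairing.
Qed.

Lemma run_never_uncopied i a : (c i).1.1 <> Uncopied a.
Proof.
move=> ci; have := run_tracks i; rewrite /tracks ci => -[p [pi lp xp _]].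
have [r [pr Tr _]] := wf_copy wf lp; pose j := (i + r).+1.
have cj : c j = c i by apply: (uncopied_stays ci); rewrite leqW // leq_addr.
have := run_tracks j;
  rewrite /tracks cj ci xp => -[p' [_ _ /event_time_inj <- /(_ r)]].
by apply; rewrite // pr ltnS leq_addl.
Qed.

End Run.

Lemma well_formed_not_lang : ~ lang (detector F n) w.
Proof.
move=> /detector_langP[q q0 [c [c0 hc acc]]].
have tr0 : tracks 0 (c 0) by rewrite c0; case/orP: q0 => /eqP ->.
have [i _] := acc 0; case E: (c i).1.1 => [||||||l|a] // _.
- exact: run_never_violated E.
- exact: run_never_unsignaled E.
- exact: run_never_uncopied E.
Qed.

End Soundness.

Lemma lang_detector : lang (detector F n) w <-> ~ well_formed F n T letter.
Proof.
split; last exact: not_well_formed_lang.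
by move=> lw wf; exact: well_formed_not_lang wf lw.
Qed.

End DetectorRuns.

(** * Expressions with an oracle *)

Definition nsqrt n := iter n (fun s => s + (s.+1 * s.+1 <= n)) 0.
Definition npair a b := (a + b) * (a + b) + b.
Definition nsnd n := n - nsqrt n * nsqrt n.
Definition nfst n := nsqrt n - nsnd n.

Lemma nsqrtP n : nsqrt n * nsqrt n <= n < (nsqrt n).+1 * (nsqrt n).+1.
Proof.
suff bounds k : let s := iter k (fun s => s + (s.+1 * s.+1 <= n)) 0 in
    s * s <= n /\ (s = k \/ n < s.+1 * s.+1).
  by have := bounds n; rewrite -/(nsqrt n) /= => -[le_s [e|?]]; nia.
elim: k => [|k [le_s lt_s]] /=; first by split; [|left].
move: (iter _ _ _) le_s lt_s => s le_s lt_s.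
case: (leqP (s.+1 * s.+1) n) => h; rewrite ?addn1 ?addn0; split=> //;
  last by right.
by left; case: lt_s => ?; lia.
Qed.

Lemma nsqrt_pair a b : nsqrt (npair a b) = a + b.
Proof. by have := nsqrtP (npair a b); rewrite /npair; nia. Qed.

Lemma nsnd_pair a b : nsnd (npair a b) = b.
Proof. by rewrite /nsnd nsqrt_pair /npair addKn. Qed.

Lemma nfst_pair a b : nfst (npair a b) = a.
Proof. by rewrite /nfst nsnd_pair nsqrt_pair addnK. Qed.

Inductive expr :=
| EVar of nat
| EZero
| ESucc of expr
| EPred of expr
| EIter of expr & expr & expr
| EQuery of expr.

(* [EIter a b h] binds the accumulator as the variable 0 of [h]. *)
Fixpoint eval (W : pred nat) (e : expr) (rho : nat -> nat) : nat :=
  match e with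
  | EVar i => rho i
  | EZero => 0
  | ESucc a => (eval W a rho).+1
  | EPred a => (eval W a rho).-1
  | EIter a b h =>
      iter (eval W a rho) (fun x => eval W h (scons x rho)) (eval W b rho)
  | EQuery a => W (eval W a rho)
  end.

Fixpoint rename (f : nat -> nat) (e : expr) : expr :=
  match e with
  | EVar i => EVar (f i)
  | EZero => EZero
  | ESucc a => ESucc (rename f a)
  | EPred a => EPred (rename f a)
  | EIter a b h =>
      EIter (rename f a) (rename f b) (rename (scons 0 (succn \o f)) h)
  | EQuery a => EQuery (rename f a)
  end.

Definition shift := rename succn.

Definition econst n := iter n ESucc EZero.
Definition eadd a b := EIter b a (ESucc (EVar 0)).
Definition esub a b := EIter b a (EPred (EVar 0)).
Definition emul a b := EIter b EZero (eadd (EVar 0) (shift a)).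
Definition enot a := esub (econst 1) a.
Definition eimp a b := eadd (enot a) b.
Definition eeq a b := enot (eadd (esub a b) (esub b a)).
Definition epair a b := eadd (emul (eadd a b) (eadd a b)) b.
Definition esqrt a := EIter a EZero
  (eadd (EVar 0)
    (enot (esub (emul (ESucc (EVar 0)) (ESucc (EVar 0))) (shift a)))).
Definition esnd a := esub a (emul (esqrt a) (esqrt a)).
Definition efst a := esub (esqrt a) (esnd a).

Section Evaluation.
Variable W : pred nat.

Lemma eval_rename e f rho : eval W (rename f e) rho = eval W e (rho \o f).
Proof.
elim: e f rho => //= [a IHa|a IHa|a IHa b IHb h IHh|a IHa] f rho;
  rewrite ?IHa ?IHb //.
by apply: eq_iter => x; rewrite IHh; congr eval; apply/funext; case.
Qed.

Lemma eval_shift e x rho : eval W (shift e) (scons x rho) = eval W e rho.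
Proof. by rewrite eval_rename; congr eval; apply/funext. Qed.

Lemma eval_const n rho : eval W (econst n) rho = n.
Proof. by elim: n => //= n ->. Qed.

Lemma eval_add a b rho : eval W (eadd a b) rho = eval W a rho + eval W b rho.
Proof.
by rewrite /=; elim: (eval W b rho) => [|n /= ->]; rewrite ?addn0 ?addnS.
Qed.

Lemma eval_sub a b rho : eval W (esub a b) rho = eval W a rho - eval W b rho.
Proof.
by rewrite /=; elim: (eval W b rho) => [|n /= ->]; rewrite ?subn0 ?subnS.
Qed.

Lemma eval_mul a b rho : eval W (emul a b) rho = eval W a rho * eval W b rho.
Proof.
rewrite [LHS]/=; elim: (eval W b rho) => [|n IHn]; first by rewrite muln0.
by rewrite iterS IHn -[X in X = _]/(eval W (eadd (EVar 0) (shift a)) _)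
  eval_add eval_shift mulnS addnC.
Qed.

Lemma eval_not a rho : eval W (enot a) rho = (eval W a rho == 0).
Proof. by rewrite eval_sub /=; case: (eval W a rho). Qed.

Lemma eval_eq a b rho : eval W (eeq a b) rho = (eval W a rho == eval W b rho).
Proof. by rewrite eval_not eval_add !eval_sub addn_eq0 !subn_eq0 -eqn_leq. Qed.

Lemma eval_pair a b rho :
  eval W (epair a b) rho = npair (eval W a rho) (eval W b rho).
Proof. by rewrite !(eval_add, eval_mul). Qed.

Lemma eval_sqrt a rho : eval W (esqrt a) rho = nsqrt (eval W a rho).
Proof.
rewrite /esqrt; set h := eadd _ _.
rewrite -[LHS]/(iter (eval W a rho) (fun s => eval W h (scons s rho)) 0).
apply: eq_iter => s; rewrite /h eval_add eval_not eval_sub eval_mul eval_shift.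
by rewrite subn_eq0.
Qed.

Lemma eval_snd a rho : eval W (esnd a) rho = nsnd (eval W a rho).
Proof. by rewrite eval_sub eval_mul eval_sqrt. Qed.

Lemma eval_fst a rho : eval W (efst a) rho = nfst (eval W a rho).
Proof. by rewrite eval_sub eval_snd eval_sqrt. Qed.

Definition true_at (e : expr) (rho : nat -> nat) : Prop := 0 < eval W e rho.

Lemma true_query a rho : true_at (EQuery a) rho <-> W (eval W a rho).
Proof. by rewrite /true_at /= lt0b. Qed.

Lemma true_eq a b rho : true_at (eeq a b) rho <-> eval W a rho = eval W b rho.
Proof. by rewrite /true_at eval_eq lt0b; split=> /eqP. Qed.

Lemma true_lt a b rho : true_at (esub b a) rho <-> eval W a rho < eval W b rho.
Proof. by rewrite /true_at eval_sub subn_gt0. Qed.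

Lemma true_not a rho : true_at (enot a) rho <-> ~ true_at a rho.
Proof. by rewrite /true_at eval_not lt0b lt0n; split=> [-> //|/negP/negbNE]. Qed.

Lemma true_and a b rho :
  true_at (emul a b) rho <-> true_at a rho /\ true_at b rho.
Proof. by rewrite /true_at eval_mul muln_gt0; split=> /andP. Qed.

Lemma true_or a b rho : true_at (eadd a b) rho <-> true_at a rho \/ true_at b rho.
Proof. by rewrite /true_at eval_add addn_gt0; split=> /orP. Qed.

Lemma true_imp a b rho :
  true_at (eimp a b) rho <-> (true_at a rho -> true_at b rho).
Proof.
rewrite true_or true_not; split=> [[na /na|]|ab] //.
by have [/ab|] := pselect (true_at a rho); [right|left].
Qed.

End Evaluation.

(** * Arithmetical truth relative to an oracle *)

Fixpoint term_code (t : term) : nat :=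
  match t with
  | TVar i => CodeSeq.code [:: 0; i]
  | TZero => CodeSeq.code [:: 1]
  | TSucc t => CodeSeq.code [:: 2; term_code t]
  | TAdd t u => CodeSeq.code [:: 3; term_code t; term_code u]
  | TMul t u => CodeSeq.code [:: 4; term_code t; term_code u]
  end.

Lemma term_code_inj : injective term_code.
Proof.
elim=> [i||t IHt|t IHt u IHu|t IHt u IHu] [j||t'|t' u'|t' u'] //.
all: move=> /code_inj e; case: e => //.
- by move=> ->.
- by move=> /IHt ->.
- by move=> /IHt -> /IHu ->.
- by move=> /IHt -> /IHu ->.
Qed.

Fixpoint form_code (p : form) : nat :=
  match p with
  | FEq t u => CodeSeq.code [:: 0; term_code t; term_code u]
  | FLt t u => CodeSeq.code [:: 1; term_code t; term_code u]
  | FMem t i => CodeSeq.code [:: 2; term_code t; i]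
  | FNot p => CodeSeq.code [:: 3; form_code p]
  | FAnd p q => CodeSeq.code [:: 4; form_code p; form_code q]
  | FOr p q => CodeSeq.code [:: 5; form_code p; form_code q]
  | FImp p q => CodeSeq.code [:: 6; form_code p; form_code q]
  | FAll p => CodeSeq.code [:: 7; form_code p]
  | FEx p => CodeSeq.code [:: 8; form_code p]
  | FAllSet p => CodeSeq.code [:: 9; form_code p]
  | FExSet p => CodeSeq.code [:: 10; form_code p]
  end.

Lemma form_code_inj : injective form_code.
Proof.
elim=> [t u|t u|t i|p IHp|p IHp q IHq|p IHp q IHq|p IHp q IHq|p IHp|p IHp|p IHp
  |p IHp]
  [t' u'|t' u'|t' i'|p'|p' q'|p' q'|p' q'|p'|p'|p'|p'] //.
all: move=> /code_inj e; case: e => //.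
- by move=> /term_code_inj -> /term_code_inj ->.
- by move=> /term_code_inj -> /term_code_inj ->.
- by move=> /term_code_inj -> ->.
- by move=> /IHp ->.
- by move=> /IHp -> /IHq ->.
- by move=> /IHp -> /IHq ->.
- by move=> /IHp -> /IHq ->.
all: by move=> /IHp ->.
Qed.

HB.instance Definition _ := Equality.copy form (inj_type form_code_inj).

(* The number [c] codes the environment [nfst c, nfst (nsnd c), ...]. *)
Definition decode_env (c i : nat) : nat := nfst (iter i nsnd c).

Lemma decode_env_pair x c : decode_env (npair x c) = scons x (decode_env c).
Proof.
apply/funext => -[|i]; rewrite /decode_env /=; first by rewrite nfst_pair.
by rewrite -iterS iterSr nsnd_pair.
Qed.

Lemma decode_env0 : decode_env 0 = fun=> 0.
Proof.
by apply/funext => i; rewrite /decode_env; elim: i => // i; rewrite iterSr.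
Qed.

(* An oracle stores the values of the set variables and, for every quantified
   formula, the codes of the environments which satisfy it. *)
Definition oracle_set (W : pred nat) (j : nat) : set nat :=
  [set x | W (npair 0 (npair j x))].

Definition oracle_form (W : pred nat) (p : form) (c : nat) : bool :=
  W (npair (form_code p).+1 c).

Fixpoint oracle_holds (W : pred nat) (c : nat) (p : form) : Prop :=
  match p with
  | FEq t u => teval (decode_env c) t = teval (decode_env c) u
  | FLt t u => teval (decode_env c) t < teval (decode_env c) u
  | FMem t j => oracle_set W j (teval (decode_env c) t)
  | FNot p => ~ oracle_holds W c p
  | FAnd p q => oracle_holds W c p /\ oracle_holds W c q
  | FOr p q => oracle_holds W c p \/ oracle_holds W c q
  | FImp p q => oracle_holds W c p -> oracle_holds W c q
  | _ => oracle_form W p c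
  end.

Fixpoint quantified (p : form) : seq form :=
  match p with
  | FNot p => quantified p
  | FAnd p q | FOr p q | FImp p q => quantified p ++ quantified q
  | FAll q | FEx q => p :: quantified q
  | _ => [::]
  end.

(* Tarski's clause for the quantified formula [p] at the environment [c]: its
   existential part is witnessed by [y], its universal part is tested on [z]. *)
Definition clause (W : pred nat) (p : form) (c z y : nat) : Prop :=
  match p with
  | FEx q => (oracle_form W p c -> oracle_holds W (npair y c) q) /\
             (oracle_holds W (npair z c) q -> oracle_form W p c)
  | FAll q => (oracle_form W p c -> oracle_holds W (npair z c) q) /\
              (oracle_holds W (npair y c) q -> oracle_form W p c)
  | _ => True
  end.

Definition tarskian (W : pred nat) (s : seq form) : Prop :=
  forall q, q \in s -> forall c z, exists y, clause W q c z y.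

Lemma tarskian_cat W s s' : tarskian W (s ++ s') -> tarskian W s /\ tarskian W s'.
Proof. by move=> tW; split=> q qs; apply: tW; rewrite mem_cat qs ?orbT. Qed.

Lemma tarskian_cons W q s :
  tarskian W (q :: s) -> tarskian W [:: q] /\ tarskian W s.
Proof. exact: (@tarskian_cat W [:: q]). Qed.

Lemma tarskian_holds W p : arithmetical p -> tarskian W (quantified p) ->
  forall c, oracle_holds W c p <-> holds (decode_env c) (oracle_set W) p.
Proof.
elim: p => //= [p IHp|p IHp q IHq|p IHp q IHq|p IHp q IHq|p IHp|p IHp].
- by move=> ap tW c; have := IHp ap tW c; tauto.
1-3: by move=> /andP[ap aq] /tarskian_cat[tp tq] c;
  have := IHp ap tp c; have := IHq aq tq c; tauto.
- move=> ap /tarskian_cons[tall tp] c; have IH := IHp ap tp.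
  have cl := tall _ (mem_head _ _); split=> [Wc n|hp].
    by rewrite -decode_env_pair -IH; have [y [/(_ Wc)]] := cl c n.
  by have [y [_]] := cl c 0; apply; rewrite IH decode_env_pair.
- move=> ap /tarskian_cons[tex tp] c; have IH := IHp ap tp.
  have cl := tex _ (mem_head _ _); split=> [Wc|[n hn]].
    by have [y [/(_ Wc) hy _]] := cl c 0; exists y; rewrite -decode_env_pair -IH.
  by have [y [_]] := cl c n; apply; rewrite IH decode_env_pair.
Qed.

Definition truth_oracle (E : nat -> set nat) : pred nat := fun z =>
  `[< nfst z = 0 /\ E (nfst (nsnd z)) (nsnd (nsnd z)) \/
      exists2 p, nfst z = (form_code p).+1 & holds (decode_env (nsnd z)) E p >].

Lemma oracle_set_truth E : oracle_set (truth_oracle E) = E.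
Proof.
apply/funext => j; apply/seteqP; split=> x; rewrite /oracle_set /truth_oracle /=.
  by move/asboolP; rewrite !(nfst_pair, nsnd_pair) => -[[]|[p]].
by move=> Ex; apply/asboolP; rewrite !(nfst_pair, nsnd_pair); left.
Qed.

Lemma oracle_form_truth E p c :
  oracle_form (truth_oracle E) p c <-> holds (decode_env c) E p.
Proof.
rewrite /oracle_form /truth_oracle; split=> [/asboolP|hp]; last apply/asboolP;
  rewrite !(nfst_pair, nsnd_pair).
  by case=> [[]|[q [/form_code_inj ->]]].
by right; exists p.
Qed.

Lemma oracle_holds_truth E p c : arithmetical p ->
  oracle_holds (truth_oracle E) c p <-> holds (decode_env c) E p.
Proof.
elim: p => //= [t j|p IHp|p IHp q IHq|p IHp q IHq|p IHp q IHq|p IHp|p IHp].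
- by rewrite oracle_set_truth.
- by move=> /IHp; tauto.
1-3: by move=> /andP[/IHp hp /IHq hq]; tauto.
all: by rewrite oracle_form_truth.
Qed.

Lemma quantified_arithmetical p q :
  arithmetical p -> q \in quantified p -> arithmetical q.
Proof.
elim: p => //= [p IHp r IHr|p IHp r IHr|p IHp r IHr|p IHp|p IHp].
1-3: by move=> /andP[/IHp hp /IHr hr]; rewrite mem_cat => /orP[].
all: by move=> ap; rewrite in_cons => /orP[/eqP->|/(IHp ap)].
Qed.

Lemma truth_oracle_tarskian E p : arithmetical p ->
  tarskian (truth_oracle E) (quantified p).
Proof.
move=> ap q /(quantified_arithmetical ap); case: q => //=; do ?[by exists 0].
- move=> q aq c z.
  have [y hy] : exists y, holds (scons y (decode_env c)) E q ->
    forall n, holds (scons n (decode_env c)) E q.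
    have [[y ny]|no] := pselect (exists y, ~ holds (scons y (decode_env c)) E q);
      first by exists y.
    by exists 0 => _ n; apply: contrapT => hn; apply: no; exists n.
  exists y; rewrite oracle_form_truth !oracle_holds_truth // !decode_env_pair.
  by split.
- move=> q aq c z.
  have [y hy] : exists y, (exists n, holds (scons n (decode_env c)) E q) ->
    holds (scons y (decode_env c)) E q.
    by have [[y hy]|no] := pselect (exists y, holds (scons y (decode_env c)) E q);
      [exists y|exists 0].
  exists y; rewrite oracle_form_truth !oracle_holds_truth // !decode_env_pair.
  by split=> // hz; exists z.
Qed.

Fixpoint term_expr (t : term) (c : expr) : expr :=
  match t with
  | TVar i => efst (iter i esnd c)
  | TZero => EZero
  | TSucc t => ESucc (term_expr t c)
  | TAdd t u => eadd (term_expr t c) (term_expr u c)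
  | TMul t u => emul (term_expr t c) (term_expr u c)
  end.

Definition oracle_expr (p : form) (c : expr) : expr :=
  EQuery (epair (econst (form_code p).+1) c).

Fixpoint form_expr (p : form) (c : expr) : expr :=
  match p with
  | FEq t u => eeq (term_expr t c) (term_expr u c)
  | FLt t u => esub (term_expr u c) (term_expr t c)
  | FMem t j => EQuery (epair EZero (epair (econst j) (term_expr t c)))
  | FNot p => enot (form_expr p c)
  | FAnd p q => emul (form_expr p c) (form_expr q c)
  | FOr p q => eadd (form_expr p c) (form_expr q c)
  | FImp p q => eimp (form_expr p c) (form_expr q c)
  | _ => oracle_expr p c
  end.

Definition clause_expr (p : form) (c z y : expr) : expr :=
  match p with
  | FEx q => emul (eimp (oracle_expr p c) (form_expr q (epair y c)))
                  (eimp (form_expr q (epair z c)) (oracle_expr p c))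
  | FAll q => emul (eimp (oracle_expr p c) (form_expr q (epair z c)))
                   (eimp (form_expr q (epair y c)) (oracle_expr p c))
  | _ => econst 1
  end.

Definition clauses_expr (s : seq form) (i c z y : expr) : expr :=
  foldr (fun p =>
    emul (eimp (eeq i (econst (form_code p))) (clause_expr p c z y))) (econst 1) s.

(* Variables: 0 is the instance, 1 the code [npair i (npair c z)] of the test of
   the clause of the formula of code [i] at [c] on [z], and 2 its witness. *)
Definition refutation_expr (p : form) : expr :=
  let m := EVar 1 in
  emul (enot (form_expr p (epair (EVar 0) EZero)))
    (clauses_expr (quantified p)
      (efst m) (efst (esnd m)) (esnd (esnd m)) (EVar 2)).

Definition refutation_test (W : pred nat) (p : form) (n m y : nat) : Prop :=
  ~ oracle_holds W (npair n 0) p /\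
  forall q, q \in quantified p -> nfst m = form_code q ->
    clause W q (nfst (nsnd m)) (nsnd (nsnd m)) y.

Section Expressions.
Variable W : pred nat.

Lemma eval_term t c rho :
  eval W (term_expr t c) rho = teval (decode_env (eval W c rho)) t.
Proof.
elim: t => [i||t IHt|t IHt u IHu|t IHt u IHu].
- rewrite eval_fst /decode_env [teval _ _]/=; congr nfst.
  by elim: i => [//|i IHi]; rewrite !iterS eval_snd IHi.
- by [].
- by rewrite /= IHt.
- by rewrite eval_add IHt IHu.
- by rewrite eval_mul IHt IHu.
Qed.

Lemma true_oracle p c rho :
  true_at W (oracle_expr p c) rho <-> oracle_form W p (eval W c rho).
Proof. by rewrite true_query eval_pair eval_const. Qed.

Lemma true_form p c rho :
  true_at W (form_expr p c) rho <-> oracle_holds W (eval W c rho) p.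
Proof.
elim: p => [t u|t u|t j|p IHp|p IHp q IHq|p IHp q IHq|p IHp q IHq|p _|p _|p _|p _].
- by rewrite true_eq !eval_term.
- by rewrite true_lt !eval_term.
- by rewrite true_query !eval_pair eval_const eval_term.
- by rewrite true_not IHp.
- by rewrite true_and IHp IHq.
- by rewrite true_or IHp IHq.
- by rewrite true_imp IHp IHq.
all: exact: true_oracle.
Qed.

Lemma true_clause p c z y rho : true_at W (clause_expr p c z y) rho <->
  clause W p (eval W c rho) (eval W z rho) (eval W y rho).
Proof.
by case: p => // p; rewrite true_and !true_imp true_oracle !true_form !eval_pair.
Qed.

Lemma true_clauses s i c z y rho : true_at W (clauses_expr s i c z y) rho <->
  forall p, p \in s -> eval W i rho = form_code p ->
    clause W p (eval W c rho) (eval W z rho) (eval W y rho).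
Proof.
elim: s => [|p s IHs]; first by split.
rewrite true_and IHs true_imp true_eq eval_const true_clause.
split=> [[hp hs] q|h]; first by rewrite in_cons => /orP[/eqP-> /hp|/hs].
by split=> [|q qs]; apply: h; rewrite in_cons ?eqxx ?qs ?orbT.
Qed.

Lemma true_refutation p rho :
  true_at W (refutation_expr p) rho <->
  refutation_test W p (rho 0) (rho 1) (rho 2).
Proof.
by rewrite true_and true_not true_form eval_pair true_clauses !(eval_fst, eval_snd).
Qed.

End Expressions.

Lemma refutationP p n : arithmetical p ->
  (exists E, ~ holds (scons n (fun=> 0)) E p) <->
  exists W, forall m, exists y, refutation_test W p n m y.
Proof.
move=> ap; have -> : scons n (fun=> 0) = decode_env (npair n 0).
  by rewrite decode_env_pair decode_env0.
split=> [[E hE]|[W hW]].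
  exists (truth_oracle E) => m.
  have np : ~ oracle_holds (truth_oracle E) (npair n 0) p
    by rewrite oracle_holds_truth.
  have [[q qp mq]|no] :=
    pselect (exists2 q, q \in quantified p & nfst m = form_code q).
    have [y hy] := truth_oracle_tarskian E ap qp (nfst (nsnd m)) (nsnd (nsnd m)).
    by exists y; split=> // r rp; rewrite mq => /form_code_inj <-.
  by exists 0; split=> // q qp mq; case: no; exists q.
exists (oracle_set W); rewrite -tarskian_holds //; first by have [y []] := hW 0.
move=> q qp c z; have [y [_ /(_ q qp)]] := hW (npair (form_code q) (npair c z)).
by rewrite !(nfst_pair, nsnd_pair) => /(_ erefl) hy; exists y.
Qed.

Lemma pi11_normal_form B : pi11 B -> exists2 p, arithmetical p &
  forall n, B n <-> forall E, holds (scons n (fun=> 0)) E p.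
Proof.
move=> [phi hphi hB].
suff [p ap hp] : exists2 p, arithmetical p &
    forall e, (forall E, holds e E phi) <-> (forall E, holds e E p).
  exists p => // n; rewrite -hp; split=> [Bn E|h]; first by rewrite -hB.
  exact/(hB n (fun=> 0) (fun=> set0)).
elim: phi {hB} hphi => //; do ?[by move=> *; eexists; [eassumption|]].
move=> p IHp /IHp[q aq hq]; exists q => // e; rewrite -hq; split=> h E /=.
  have := h (E \o succn) (E 0); congr holds; apply/funext.
  by case.
by move=> X; apply: h.
Qed.

(** * Counter machines with an oracle *)

Definition update (s : nat -> nat) (r x : nat) : nat -> nat :=
  fun i => if i == r then x else s i.

Lemma update_same s r x : update s r x r = x.
Proof. by rewrite /update eqxx. Qed.

Lemma update_other s r x i : i != r -> update s r x i = s i.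
Proof. by rewrite /update => /negPf ->. Qed.

Inductive command :=
| CInc of nat
| CDec of nat
| CClear of nat
| CSeq of command & command
| CLoop of nat & command
| CQuery of nat & command.

Fixpoint exec (W : pred nat) (c : command) (s : nat -> nat) : nat -> nat :=
  match c with
  | CInc r => update s r (s r).+1
  | CDec r => update s r (s r).-1
  | CClear r => update s r 0
  | CSeq c1 c2 => exec W c2 (exec W c1 s)
  | CLoop r c => iter (s r) (fun s => exec W c (update s r (s r).-1)) s
  | CQuery r c => if W (s r) then exec W c s else s
  end.

(* [exec] agrees with the machine code of a loop only when the body leaves the
   loop counter alone. *)
Fixpoint loop_safe (c : command) : Prop :=
  match c with
  | CSeq c1 c2 => loop_safe c1 /\ loop_safe c2
  | CLoop r c => loop_safe c /\ forall W s, exec W c s r = s r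
  | CQuery _ c => loop_safe c
  | _ => True
  end.

Definition move_reg r d := CSeq (CClear d) (CLoop r (CInc d)).

Definition copy_reg r d := CSeq (CSeq (CClear d) (CClear d.+1))
  (CSeq (CLoop r (CSeq (CInc d) (CInc d.+1))) (CLoop d.+1 (CInc r))).

(* The value of [e] is left in the register [d]; the variable [i] is kept in the
   register [mu i < d], and the registers from [d] on are scratch. *)
Fixpoint compile (e : expr) (mu : nat -> nat) (d : nat) : command :=
  match e with
  | EVar i => copy_reg (mu i) d
  | EZero => CClear d
  | ESucc a => CSeq (compile a mu d) (CInc d)
  | EPred a => CSeq (compile a mu d) (CDec d)
  | EIter a b h =>
      CSeq (compile b mu d) (CSeq (compile a mu d.+1)
        (CLoop d.+1 (CSeq (compile h (scons d mu) d.+2) (move_reg d.+2 d))))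
  | EQuery a => CSeq (compile a mu d.+1) (CSeq (CClear d) (CQuery d.+1 (CInc d)))
  end.

Section Compile.
Variable W : pred nat.

Lemma exec_seq c1 c2 s : exec W (CSeq c1 c2) s = exec W c2 (exec W c1 s).
Proof. by []. Qed.

Lemma exec_loop_ind r c (I : nat -> (nat -> nat) -> Prop) s : I 0 s ->
  (forall k t, I k t -> I k.+1 (exec W c (update t r (t r).-1))) ->
  I (s r) (exec W (CLoop r c) s).
Proof. by move=> I0 IS; rewrite /=; elim: (s r) => // k IHk; exact: IS. Qed.

Lemma exec_loop_add r c (a : nat -> nat) s : a r = 0 ->
  (forall t, exec W c t = fun i => t i + a i) ->
  exec W (CLoop r c) s = update (fun i => s i + s r * a i) r 0.
Proof.
move=> ar hc; have : exec W (CLoop r c) s =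
    update (fun i => s i + s r * a i) r (s r - s r).
  apply: (@exec_loop_ind r c
      (fun k t => t = update (fun i => s i + k * a i) r (s r - k))).
    by apply/funext => i; rewrite /update subn0 mul0n addn0; case: eqP => [->|].
  move=> k t ->; rewrite hc update_same; apply/funext => i.
  rewrite /update; case: eqP => [->|_]; first by rewrite ar addn0 subnS.
  by rewrite mulSn addnAC -addnA.
by rewrite subnn.
Qed.

Lemma exec_move_reg r d s : r != d ->
  exec W (move_reg r d) s = update (update s r 0) d (s r).
Proof.
move=> rd; rewrite /move_reg exec_seq (@exec_loop_add _ _ (fun i => i == d));
  last first.
- by move=> t; apply/funext => i /=; rewrite /update; case: eqP => [->|];
    rewrite ?addn1 ?addn0.
- by rewrite (negPf rd).
apply/funext => i; rewrite /= /update (negPf rd).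
by have [->|_] := eqVneq i d; rewrite ?muln1 ?muln0 ?addn0 // eq_sym (negPf rd).
Qed.

Lemma exec_copy_reg r d s : r < d ->
  exec W (copy_reg r d) s = update (update s d (s r)) d.+1 0.
Proof.
move=> rd; rewrite /copy_reg !exec_seq.
rewrite (@exec_loop_add r _ (fun i => (i == d) + (i == d.+1))); last 2 first.
- by rewrite !ltn_eqF // leqW.
- move=> t; apply/funext => i /=; rewrite /update.
  by do ![case: eqP => ? //=]; subst; lia.
rewrite (@exec_loop_add _ _ (fun i => i == r)); last 2 first.
- by rewrite gtn_eqF // leqW.
- by move=> t; apply/funext => i /=; rewrite /update; case: eqP => [->|];
    rewrite ?addn1 ?addn0.
by apply/funext => i; rewrite /= /update; do ![case: eqP => ? //=]; subst; lia.
Qed.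

Definition stores (c : command) (s : nat -> nat) (d v : nat) : Prop :=
  exec W c s d = v /\ forall r, r < d -> exec W c s r = s r.

Lemma stores_iter_body h mu d s t : (forall i, mu i < d) ->
  (forall s, stores (compile h (scons d mu) d.+2) s d.+2
    (eval W h (s \o scons d mu))) ->
  (forall r, r < d -> t r = s r) ->
  let c := CSeq (compile h (scons d mu) d.+2) (move_reg d.+2 d) in
  exec W c t d = eval W h (scons (t d) (s \o mu)) /\
  forall r, r < d -> exec W c t r = s r.
Proof.
move=> mu_lt hstores ts c; have [value kept] := hstores t.
rewrite /c exec_seq exec_move_reg ?gtn_eqF //; split=> [|r rd].
  rewrite update_same value; congr eval; apply/funext => -[|i] //=.
  exact: ts.
by rewrite !update_other ?kept ?ts //; lia.
Qed.

Lemma stores_iter a b h mu d s : (forall i, mu i < d) ->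
  (forall s, stores (compile b mu d) s d (eval W b (s \o mu))) ->
  (forall s, stores (compile a mu d.+1) s d.+1 (eval W a (s \o mu))) ->
  (forall s, stores (compile h (scons d mu) d.+2) s d.+2
    (eval W h (s \o scons d mu))) ->
  stores (compile (EIter a b h) mu d) s d (eval W (EIter a b h) (s \o mu)).
Proof.
move=> mu_lt b_stores a_stores h_stores;
  rewrite /stores [compile _ _ _]/= !exec_seq.
have [b_value b_kept] := b_stores s.
set s1 := exec W (compile b mu d) s in b_value b_kept *.
have [a_value a_kept] := a_stores s1.
set s2 := exec W (compile a mu d.+1) s1 in a_value a_kept *.
have s1E : s1 \o mu = s \o mu by apply/funext => i /=; exact: b_kept.
pose acc k := iter k (fun x => eval W h (scons x (s \o mu))) (eval W b (s \o mu)).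
have [] // := @exec_loop_ind d.+1
  (CSeq (compile h (scons d mu) d.+2) (move_reg d.+2 d))
  (fun k t => t d = acc k /\ forall r, r < d -> t r = s r) s2.
- by split=> [|r rd]; rewrite a_kept ?b_value ?b_kept // leqW.
- move=> k t [td ts].
  have ts' r : r < d -> update t d.+1 (t d.+1).-1 r = s r.
    by move=> rd; rewrite update_other ?ts // ltn_eqF // ltnW.
  have [-> kept] := stores_iter_body mu_lt h_stores ts'.
  by rewrite update_other ?td // ltn_eqF.
by rewrite a_value s1E.
Qed.

Lemma compileP e mu d s : (forall i, mu i < d) ->
  stores (compile e mu d) s d (eval W e (s \o mu)).
Proof.
elim: e mu d s => [i||a IHa|a IHa|a IHa b IHb h IHh|a IHa] mu d s mu_lt.
- rewrite /stores [compile _ _ _]/= exec_copy_reg //.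
  split=> [|r rd]; first by rewrite update_other ?update_same // ltn_eqF.
  by rewrite !update_other // ltn_eqF // leqW.
- by split=> [|r rd] /=; rewrite ?update_same // update_other // ltn_eqF.
1-2: by have [value kept] := IHa mu d s mu_lt; split=> [|r rd] /=;
  rewrite ?update_same ?value // update_other ?kept // ltn_eqF.
- apply: stores_iter => // [s'|s'|s']; first exact: IHb.
    by apply: IHa => i; exact: leqW.
  by apply: IHh => -[|i] //=; rewrite ltnW ?ltnS // ltnW.
- have mu_lt1 i : mu i < d.+1 by exact: leqW.
  have [value kept] := IHa mu d.+1 s mu_lt1.
  rewrite /stores [compile _ _ _]/= !exec_seq [exec _ (CQuery _ _) _]/=.
  rewrite [_ d.+1]update_other ?gtn_eqF // value /=.
  by split=> [|r rd]; case: (W _);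
    rewrite /= ?update_same // !update_other ?kept // ?ltn_eqF // ltnW.
Qed.

End Compile.

Lemma compile_loop_safe e mu d :
  (forall i, mu i < d) -> loop_safe (compile e mu d).
Proof.
elim: e mu d => [i||a IHa|a IHa|a IHa b IHb h IHh|a IHa] mu d mu_lt //=.
- split=> //; split; split=> // W s.
    by rewrite !update_other // ltn_eqF // leqW.
  by rewrite update_other // gtn_eqF // leqW.
1-2: by split; first exact: IHa.
- have mu_lt1 i : mu i < d.+1 by exact: leqW.
  have mu_lt2 i : scons d mu i < d.+2.
    by case: i => [|i] //=; rewrite ltnW ?ltnS // ltnW.
  split; first exact: IHb.
  split; first exact: IHa.
  split=> [|W s].
    split; first exact: IHh.
    by do !split=> //; move=> W s; rewrite update_other // gtn_eqF.
  rewrite -[LHS]/(exec W (move_reg d.+2 d)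
    (exec W (compile h (scons d mu) d.+2) s) d.+1).
  rewrite exec_move_reg ?gtn_eqF // !update_other; do ?lia.
  by have [_ ->] := compileP W h s mu_lt2.
- by do !split; apply: IHa => i; exact: leqW.
Qed.

Inductive instr :=
| IInc of nat & nat
| IDec of nat & nat & nat
| IQuery of nat & nat & nat
| ILoad.

Definition config := (nat * (nat -> nat))%type.

Definition run_instr (W : pred nat) (i : instr) (cf : config) : config :=
  match i with
  | IInc r q => (q, update cf.2 r (cf.2 r).+1)
  | IDec r q1 q0 => (if cf.2 r == 0 then q0 else q1, update cf.2 r (cf.2 r).-1)
  | IQuery r q1 q0 => (if W (cf.2 r) then q1 else q0, cf.2)
  | ILoad => cf
  end.

Definition machine_step (W : pred nat) (P : seq instr) (cf : config) : config :=
  run_instr W (nth ILoad P cf.1) cf.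

Fixpoint command_size (c : command) : nat :=
  match c with
  | CInc _ | CDec _ | CClear _ => 1
  | CSeq c1 c2 => command_size c1 + command_size c2
  | CLoop _ c | CQuery _ c => (command_size c).+1
  end.

(* Code placed at the address [p], which leaves to the address [k]. *)
Fixpoint assemble (c : command) (p k : nat) : seq instr :=
  match c with
  | CInc r => [:: IInc r k]
  | CDec r => [:: IDec r k k]
  | CClear r => [:: IDec r p k]
  | CSeq c1 c2 =>
      assemble c1 p (p + command_size c1) ++ assemble c2 (p + command_size c1) k
  | CLoop r c => IDec r p.+1 k :: assemble c p.+1 p
  | CQuery r c => IQuery r p.+1 k :: assemble c p.+1 k
  end.

Lemma size_assemble c p k : size (assemble c p k) = command_size c.
Proof.
by elim: c p k => //= [c1 IH1 c2 IH2|r c IH|r c IH] p k;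
  rewrite ?size_cat ?IH1 ?IH2 ?IH.
Qed.

Lemma command_size_gt0 c : 0 < command_size c.
Proof. by elim: c => //= c1 h1 c2 h2; rewrite addn_gt0 h1. Qed.

Definition code_at (P : seq instr) (s : seq instr) (p : nat) : Prop :=
  forall i, i < size s -> nth ILoad P (p + i) = nth ILoad s i.

Lemma code_at_cat P s1 s2 p : code_at P (s1 ++ s2) p ->
  code_at P s1 p /\ code_at P s2 (p + size s1).
Proof.
move=> h; split=> i il; [have := h i|have := h (size s1 + i)];
  rewrite nth_cat size_cat.
  by rewrite il; apply; exact: ltn_addr.
by rewrite ltn_add2l (ltnNge (size s1 + i)) leq_addr addKn addnA; apply.
Qed.

Lemma code_at_cons P a s p : code_at P (a :: s) p ->
  nth ILoad P p = a /\ code_at P s p.+1.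
Proof.
move=> h; split=> [|i il]; first by have := h 0; rewrite addn0; apply.
by have := h i.+1; rewrite addnS -addSn; apply.
Qed.

Section Assembly.
Variables (W : pred nat) (P : seq instr).
Implicit Type cf : config.

Definition runs_within (p p' : nat) cf cf' : Prop :=
  exists2 t, iter t (machine_step W P) cf = cf' &
    forall i, i < t -> p <= (iter i (machine_step W P) cf).1 < p'.

Lemma runs_within_refl p p' cf : runs_within p p' cf cf.
Proof. by exists 0. Qed.

Lemma runs_within_trans p p' cf1 cf2 cf3 :
  runs_within p p' cf1 cf2 -> runs_within p p' cf2 cf3 ->
  runs_within p p' cf1 cf3.
Proof.
move=> [t1 e1 h1] [t2 e2 h2]; exists (t2 + t1); first by rewrite iterD e1.
move=> i it; case: (ltnP i t1) => [/h1 //|le_t1].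
by rewrite -(subnK le_t1) iterD e1; apply: h2; rewrite ltn_subLR // addnC.
Qed.

Lemma runs_within_instr p p' q s a : nth ILoad P q = a -> p <= q < p' ->
  runs_within p p' (q, s) (run_instr W a (q, s)).
Proof. by move=> <- pq; exists 1 => // -[]. Qed.

Lemma sub_runs_within p1 p1' p2 p2' cf cf' : p2 <= p1 -> p1' <= p2' ->
  runs_within p1 p1' cf cf' -> runs_within p2 p2' cf cf'.
Proof.
move=> le_p le_p' [t et ht]; exists t => // i /ht/andP[lo up].
by rewrite (leq_trans le_p) // (leq_trans up).
Qed.

Lemma runs_clear p k s r : nth ILoad P p = IDec r p k ->
  runs_within p p.+1 (p, s) (k, update s r 0).
Proof.
move=> instrE; have here : p <= p < p.+1 by rewrite leqnn ltnSn.
have step s' := runs_within_instr s' instrE here.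
move e: (s r) => x; elim: x s e => [|x IHx] s e.
  by have := step s; rewrite /= e.
apply: runs_within_trans (step s) _; rewrite /= e /=.
rewrite (_ : update s r 0 = update (update s r x) r 0); last first.
  by apply/funext => i; rewrite /update; case: eqP.
by apply: IHx; rewrite update_same.
Qed.

Lemma runs_loop c r p k s : (forall s, exec W c s r = s r) ->
  (forall s,
    runs_within p.+1 (p.+1 + command_size c) (p.+1, s) (p, exec W c s)) ->
  nth ILoad P p = IDec r p.+1 k ->
  runs_within p (p + (command_size c).+1) (p, s) (k, exec W (CLoop r c) s).
Proof.
move=> kept body instrE.
have here : p <= p < p + (command_size c).+1 by rewrite leqnn addnS ltnS leq_addr.
have step s' := runs_within_instr s' instrE here.
rewrite /=; move e: (s r) => x; elim: x s e => [|x IHx] s e.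
  rewrite /= (_ : (k, s) = run_instr W (IDec r p.+1 k) (p, s)) //.
  rewrite /= e (_ : update s r 0 = s) //.
  by apply/funext => i; rewrite /update; case: eqP => [->|].
apply: (@runs_within_trans _ _ _ (p.+1, update s r (s r).-1)).
  by have := step s; rewrite /= e.
apply: runs_within_trans.
  by apply: sub_runs_within (body _); rewrite ?addnS ?addSn.
by rewrite iterSr; apply: IHx; rewrite kept update_same e.
Qed.

Lemma assembleP c p k s : loop_safe c -> code_at P (assemble c p k) p ->
  runs_within p (p + command_size c) (p, s) (k, exec W c s).
Proof.
elim: c p k s => [r|r|r|c1 IH1 c2 IH2|r c IH|r c IH] p k s /=.
- by move=> _ /code_at_cons[e _]; apply: (runs_within_instr s e);
    rewrite addn1 leqnn /=.
- move=> _ /code_at_cons[e _]; have := @runs_within_instr p (p + 1) _ s _ e.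
  by rewrite /= if_same addn1 leqnn ltnSn; apply.
- by move=> _ /code_at_cons[e _]; rewrite addn1; exact: runs_clear.
- move=> [safe1 safe2] /code_at_cat[code1]; rewrite size_assemble => code2.
  apply: (@runs_within_trans _ _ _ (p + command_size c1, exec W c1 s)).
    by apply: sub_runs_within (IH1 _ _ s safe1 code1); rewrite // addnA leq_addr.
  by apply: sub_runs_within (IH2 _ _ _ safe2 code2); rewrite ?leq_addr // addnA.
- by move=> [safe kept] /code_at_cons[e code]; apply: runs_loop => // s';
    exact: IH.
- move=> safe /code_at_cons[e code].
  apply: (@runs_within_trans _ _ _ (if W (s r) then p.+1 else k, s)).
    by apply: (runs_within_instr s e); rewrite leqnn addnS ltnS leq_addr.
  case: ifP => _; last exact: runs_within_refl.
  by apply: sub_runs_within (IH _ _ _ safe code); rewrite ?addnS ?addSn.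
Qed.

End Assembly.

Definition jumps (i : instr) : seq nat :=
  match i with
  | IInc _ q => [:: q]
  | IDec _ q1 q0 | IQuery _ q1 q0 => [:: q1; q0]
  | ILoad => [::]
  end.

Definition jumps_to (P : pred nat) (i : instr) : bool :=
  (jumps i != [::]) && all P (jumps i).

Lemma sub_jumps_to (P Q : pred nat) :
  subpred P Q -> subpred (jumps_to P) (jumps_to Q).
Proof. by move=> PQ i /andP[ni /(sub_all PQ) Qi]; apply/andP. Qed.

Lemma run_instr_jumps_to W (P : pred nat) i cf :
  jumps_to P i -> P (run_instr W i cf).1.
Proof.
rewrite /jumps_to; case: i => [r q|r q1 q0|r q1 q0|] //=; rewrite ?andbT //.
  by case: ifP => _ /andP[].
by case: ifP => _ /andP[].
Qed.

Lemma assemble_jumps_to c p k :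
  all (jumps_to (fun q => (q == k) || (p <= q < p + command_size c)))
    (assemble c p k).
Proof.
have weaken (P Q : pred nat) s : subpred P Q -> all (jumps_to P) s ->
  all (jumps_to Q) s.
  by move=> PQ; apply: sub_all; exact: sub_jumps_to.
elim: c p k => /= [r|r|r|c1 IH1 c2 IH2|r c IH|r c IH] p k;
  rewrite /jumps_to ?eqxx ?orbT /= ?andbT //; do ?lia.
- have c1_gt0 := command_size_gt0 c1; have c2_gt0 := command_size_gt0 c2.
  rewrite all_cat; apply/andP; split.
    by apply: weaken (IH1 p (p + command_size c1)) => q; lia.
  by apply: weaken (IH2 (p + command_size c1) k) => q; lia.
- have c_gt0 := command_size_gt0 c; apply/andP; split; first lia.
  by apply: weaken (IH p.+1 p) => q; lia.
- have c_gt0 := command_size_gt0 c; apply/andP; split; first lia.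
  by apply: weaken (IH p.+1 k) => q; lia.
Qed.

(** * The search machine *)

Section SearchProgram.
Variable e : expr.

Definition test_code : command := compile e (fun i => if i < 3 then i else 0) 3.

Definition verdict_addr : nat := (command_size test_code).+1.

Notation retry_addr := verdict_addr.+1.
Notation found_addr := verdict_addr.+2.
Notation reset_addr := verdict_addr.+3.
Notation load_addr := verdict_addr.+4.

Definition after_test : seq instr :=
  [:: IDec 3 found_addr retry_addr; IInc 2 1; IInc 1 reset_addr;
      IDec 2 reset_addr 1; ILoad].

(* Registers: 0 the instance, 1 and 2 the current pair [(m, y)], 3 the verdict
   of [e] on it. For [m = 0, 1, ...] in turn, the machine searches for the least
   [y] on which [e] holds, and visits [found_addr] once it is found. The address
   [load_addr] is the initial one, at which the register 0 is filled, up to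
   [n.+1], before the control moves to 0. *)
Definition search_program : seq instr :=
  IDec 0 1 1 :: assemble test_code 1 verdict_addr ++ after_test.

Lemma size_search_program : size search_program = load_addr.+1.
Proof. by rewrite /= size_cat size_assemble addnC. Qed.

Lemma search_program_test :
  code_at search_program (assemble test_code 1 verdict_addr) 1.
Proof. by move=> i il; rewrite /search_program add1n /= nth_cat il. Qed.

Lemma search_program_after_test i :
  nth ILoad search_program (verdict_addr + i) = nth ILoad after_test i.
Proof.
by rewrite /search_program /= nth_cat size_assemble ltnNge leq_addr addKn.
Qed.

Lemma search_program_jumps q : q < load_addr ->
  jumps_to (fun q => 0 < q < load_addr) (nth ILoad search_program q).
Proof.
move=> ql; pose ok := jumps_to (fun q => 0 < q < load_addr).
suff all_ok : all ok (take load_addr search_program).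
  have := all_nthP ILoad all_ok q; rewrite nth_take //; apply.
  by rewrite size_take size_search_program ltnSn.
rewrite /= take_cat size_assemble ifN; last by rewrite /verdict_addr; lia.
have -> : reset_addr - command_size test_code = 4 by rewrite /verdict_addr; lia.
rewrite all_cat /= !andbT /ok /jumps_to /= !ltnS !leqnn !leqnSn !leqW // !andbT.
apply: sub_all (assemble_jumps_to test_code 1 verdict_addr);
  apply: sub_jumps_to => i.
by rewrite /verdict_addr; lia.
Qed.

Definition search_conf (n : nat) (W : pred nat) (j : nat) : config :=
  if j <= n then (load_addr, update (fun=> 0) 0 j)
  else iter (j - n.+1) (machine_step W search_program)
    (0, update (fun=> 0) 0 n.+1).

Section Configurations.
Variables (n : nat) (W : pred nat).
Notation conf := (search_conf n W).

Lemma search_conf_load j : j <= n -> conf j = (load_addr, update (fun=> 0) 0 j).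
Proof. by rewrite /search_conf => ->. Qed.

Lemma search_conf_start : conf n.+1 = (0, update (fun=> 0) 0 n.+1).
Proof. by rewrite /search_conf ltnn subnn. Qed.

Lemma search_conf_iter j i : n < j ->
  conf (j + i) = iter i (machine_step W search_program) (conf j).
Proof.
move=> nj; rewrite /search_conf !ifN -?ltnNge ?ltn_addr //.
by rewrite -iterD addnBA // [i + j]addnC.
Qed.

Lemma search_confS j :
  n < j -> conf j.+1 = machine_step W search_program (conf j).
Proof. by move=> nj; rewrite -addn1 search_conf_iter. Qed.

Lemma search_conf_addr j : n.+1 < j -> 0 < (conf j).1 < load_addr.
Proof.
elim: j => // j IHj; rewrite ltnS => nj; rewrite search_confS // /machine_step.
apply: (@run_instr_jumps_to W (fun q => 0 < q < load_addr)).
apply: search_program_jumps.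
move: nj; rewrite leq_eqVlt => /orP[/eqP<-|/IHj/andP[] //].
by rewrite search_conf_start.
Qed.

Lemma search_conf_addr_lt j : n < j -> (conf j).1 < load_addr.
Proof.
by rewrite leq_eqVlt => /orP[/eqP<-|/search_conf_addr/andP[] //];
  rewrite search_conf_start.
Qed.

Lemma search_conf_addr_le j : (conf j).1 <= load_addr.
Proof.
have [jn|nj] := leqP j n; first by rewrite search_conf_load.
exact/ltnW/search_conf_addr_lt.
Qed.

Lemma search_conf_reg j r : (conf j).2 r <= j.
Proof.
have [jn|nj] := leqP j n.
  by rewrite search_conf_load //= /update; case: eqP.
rewrite -(subnKC nj); elim: (j - n.+1) => [|i IHi].
  by rewrite addn0 search_conf_start /= /update; case: eqP.
rewrite addnS search_confS ?leq_addr // /machine_step.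
move: IHi; case: (conf _) => q s /=.
by case: nth => [r0 q1|r0 q1 q2|r0 q1 q2|] /=; rewrite /update;
  try case: eqP => [->|_]; lia.
Qed.

End Configurations.

Definition recurrent (n : nat) (W : pred nat) : Prop :=
  infinitely_often (fun j => (search_conf n W j).1 = found_addr).

Section Rounds.
Variables (n : nat) (W : pred nat) (Q : nat -> nat -> Prop).
Hypothesis true_Q :
  forall rho, rho 0 = n -> true_at W e rho <-> Q (rho 1) (rho 2).
Notation conf := (search_conf n W).

Definition holds_pair (m y : nat) (s : nat -> nat) : Prop :=
  [/\ s 0 = n, s 1 = m & s 2 = y].

Definition at_round (m y t : nat) : Prop :=
  n < t /\ exists2 s, conf t = (1, s) & holds_pair m y s.

Lemma first_round : at_round 0 0 n.+2.
Proof.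
split=> //; rewrite search_confS // search_conf_start /machine_step /=.
by exists (update (update (fun=> 0) 0 n.+1) 0 n).
Qed.

Lemma round_verdict m y t : at_round m y t -> exists t' s,
  [/\ t <= t', conf t' = (verdict_addr, s), holds_pair m y s,
      (0 < s 3) <-> Q m y &
      forall i, t <= i < t' -> (conf i).1 < verdict_addr].
Proof.
move=> [nt [s ct [s0 s1 s2]]].
have mu_lt i : (if i < 3 then i else 0) < 3 by case: ifP.
have [d conf_d within] :=
  assembleP W s (compile_loop_safe e mu_lt) search_program_test.
have [value kept] := compileP W e s mu_lt.
exists (t + d), (exec W test_code s); split.
- exact: leq_addr.
- by rewrite search_conf_iter // ct.
- by split; rewrite kept.
- by rewrite value -[X in X <-> _]/(true_at _ _ _) true_Q /= ?s1 ?s2.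
move=> i /andP[ti itd]; rewrite -(subnKC ti) search_conf_iter // ct.
by have /andP[] := within (i - t) ltac:(lia).
Qed.

Lemma round_fails m y t : at_round m y t -> ~ Q m y ->
  exists2 t', t < t' & at_round m y.+1 t' /\
    forall i, t <= i < t' -> (conf i).1 != found_addr.
Proof.
move=> round_t nQ; have nt : n < t by case: round_t.
have [t' [s [tt' verdict [s0 s1 s2] sQ before]]] := round_verdict round_t.
have s3 : s 3 = 0 by case: (s 3) sQ => // k [/(_ isT)/nQ].
have retry : conf t'.+1 = (retry_addr, update s 3 0).
  rewrite search_confS ?(leq_trans nt) // verdict /machine_step.
  by have := search_program_after_test 0; rewrite addn0 /= => ->; rewrite /= s3.
have round_t'' : conf t'.+2 = (1, update (update s 3 0) 2 y.+1).
  rewrite search_confS ?ltnS ?(leq_trans (ltnW nt)) // retry /machine_step.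
  by have := search_program_after_test 1; rewrite addn1 /= => ->;
    rewrite /= /update /= s2.
exists t'.+2; first exact: leqW.
split; first by split; [lia|exists (update (update s 3 0) 2 y.+1)].
move=> i /andP[ti it']; have [it|] := ltnP i t'.
  by have := before i; rewrite ti it => /(_ isT); rewrite neq_ltn => lt;
    rewrite leqW // ltnW.
rewrite leq_eqVlt => /orP[/eqP<-|t'i];
  first by rewrite verdict /= neq_ltn ltnS leqnSn.
have -> : i = t'.+1 by lia.
by rewrite retry neq_ltn ltnSn.
Qed.

Lemma round_reset m t k s :
  n < t -> conf t = (reset_addr, s) -> holds_pair m k s ->
  exists2 t', t <= t' & at_round m 0 t'.
Proof.
elim: k t s => [|k IHk] t s nt reset [s0 s1 s2].
  exists t.+1; rewrite ?leqnSn //; split; first exact: leqW.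
  rewrite search_confS // reset /machine_step.
  have := search_program_after_test 3; rewrite addn3 /= => ->; rewrite /= s2 /=.
  by exists (update s 2 0); rewrite // /holds_pair /update /= s0 s1.
have [|||t' tt' round_t'] := IHk t.+1 (update s 2 k); first exact: leqW.
- rewrite search_confS // reset /machine_step.
  by have := search_program_after_test 3; rewrite addn3 /= => ->; rewrite /= s2.
- by split.
by exists t'; first exact: ltnW.
Qed.

Lemma round_succeeds m y t : at_round m y t -> Q m y ->
  exists t1 t', [/\ t <= t1 < t', (conf t1).1 = found_addr & at_round m.+1 0 t'].
Proof.
move=> round_t Qmy; have nt : n < t by case: round_t.
have [t' [s [tt' verdict [s0 s1 s2] /iffRL/(_ Qmy) s3 _]]] :=
  round_verdict round_t.
have nt' := leq_trans nt tt'.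
have found : conf t'.+1 = (found_addr, update s 3 (s 3).-1).
  rewrite search_confS // verdict /machine_step.
  by have := search_program_after_test 0; rewrite addn0 /= => ->;
    rewrite /= gtn_eqF.
have reset : conf t'.+2 = (reset_addr, update (update s 3 (s 3).-1) 1 m.+1).
  rewrite search_confS ?leqW // found /machine_step.
  by have := search_program_after_test 2; rewrite addn2 /= => ->;
    rewrite /= /update /= s1.
have [||t'' le_t'' round_t''] := round_reset (m := m.+1) (k := y) _ reset.
- by do 2!apply: leqW.
- by split.
by exists t'.+1, t''; rewrite found le_t'' leqW.
Qed.

Lemma next_round m t : at_round m 0 t -> (exists y, Q m y) ->
  exists t1 t', [/\ t <= t1 < t', (conf t1).1 = found_addr & at_round m.+1 0 t'].
Proof.
move=> round_t [y0 Qy0].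
have exQ : exists y, `[< Q m y >] by exists y0; apply/asboolP.
case: (ex_minnP exQ) => y /asboolP Qy min_y.
suff [t1 tt1 round_t1] : exists2 t1, t <= t1 & at_round m y t1.
  have [t2 [t' [/andP[t12 t2'] ? ?]]] := round_succeeds round_t1 Qy.
  by exists t2, t'; rewrite (leq_trans tt1).
have : forall y', y' < y -> ~ Q m y'.
  by move=> y' lt_y /asboolP/min_y; rewrite leqNgt lt_y.
elim: y {Qy min_y} => [|y IHy] nQ; first by exists t.
have [t1 tt1 round_t1] := IHy (fun y' lt_y' => nQ y' (ltnW lt_y')).
have [t2 t12 [round_t2 _]] := round_fails round_t1 (nQ y (ltnSn y)).
by exists t2; rewrite // (leq_trans tt1) // ltnW.
Qed.

Lemma endless_round m t j : at_round m 0 t -> (forall y, ~ Q m y) ->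
  t <= j -> (conf j).1 != found_addr.
Proof.
move=> round_t nQ tj.
have rounds y : exists2 t', t + y <= t' & at_round m y t' /\
    forall i, t <= i < t' -> (conf i).1 != found_addr.
  elim: y => [|y [t1 tt1 [round_t1 no1]]].
    by exists t; rewrite ?addn0 //; split=> // i; lia.
  have [t2 t12 [round_t2 no2]] := round_fails round_t1 (nQ y).
  exists t2; first by rewrite addnS (leq_ltn_trans tt1).
  split=> // i /andP[ti it2]; have [it1|t1i] := ltnP i t1.
    by apply: no1; rewrite ti.
  by apply: no2; rewrite t1i.
have [t' jt' [_ no]] := rounds j.+1; apply: no; rewrite tj (leq_trans _ jt') //.
by rewrite addnS ltnS leq_addl.
Qed.

Lemma recurrentP : recurrent n W <-> forall m, exists y, Q m y.
Proof.
split=> [rec|hQ N]; last first.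
  have rounds m : exists2 t, m <= t & at_round m 0 t.
    elim: m => [|m [t mt round_t]]; first by exists n.+2; last exact: first_round.
    have [t1 [t' [/andP[tt1 t1t'] _ round_t']]] := next_round round_t (hQ m).
    by exists t'; rewrite // (leq_ltn_trans mt) // (leq_ltn_trans tt1).
  have [t Nt round_t] := rounds N.
  have [t1 [t' [/andP[tt1 _] found _]]] := next_round round_t (hQ N).
  by exists t1; first exact: leq_trans tt1.
have round_ends m t : at_round m 0 t -> exists y, Q m y.
  move=> round_t; apply: contrapT => /forallNP nQ; have [j tj /eqP] := rec t.
  by apply/negP; exact: endless_round round_t nQ tj.
suff rounds m : exists t, at_round m 0 t.
  by move=> m; have [t /round_ends] := rounds m.
elim: m => [|m [t round_t]]; first by exists n.+2; exact: first_round.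
by have [_ [t' [_ _ round_t']]] := next_round round_t (round_ends _ _ round_t);
  exists t'.
Qed.

End Rounds.
End SearchProgram.

Notation found_addr e := (verdict_addr e).+2.
Notation load_addr e := (verdict_addr e).+4.

(** * Rows of cells *)

(* Comparison of a register of value [x] with the index [i] of a cell: 2, 1 or 0
   when [i] is smaller than, equal to or larger than [x]. *)
Definition trit (x i : nat) : nat := minn 2 (x.+1 - i).

Variant action := Keep | Up | Down.

Definition apply_action (a : action) (x : nat) : nat :=
  match a with Keep => x | Up => x.+1 | Down => x.-1 end.

Definition trit_next (t t' : nat) : bool := if t == 2 then 0 < t' else t' == 0.

(* [t'] is a possible value of the copy of a cell of value [t], which is the
   first one of its row if [start]. *)
Definition trit_copy (a : action) (start : bool) (t t' : nat) : bool :=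
  match a with
  | Keep => t' == t
  | Up => if t == 0 then t' < 2 else t' == 2
  | Down => if t == 2 then 0 < t' else t' == (start && (t == 1))
  end.

Lemma trit_rowP (t : nat -> nat) k : 0 < t 0 -> t k <= 1 ->
  (forall i, i <= k -> t i <= 2) ->
  (forall i, i < k -> trit_next (t i) (t i.+1)) ->
  exists2 x, x <= k & forall i, i <= k -> t i = trit x i.
Proof.
elim: k t => [|k IHk] t t0 tk t2 tN.
  by exists 0 => // i; rewrite leqn0 => /eqP ->; rewrite /trit; lia.
have t01 := tN 0 isT; move: t01; rewrite /trit_next;
  case: eqP => [t0_2 t1|t0_2 /eqP t1].
  have [||i ik|i ik|x xk tx] := IHk (fun i => t i.+1) => //;
    [exact: t2|exact: tN|].
  exists x.+1 => // -[_|i ik]; first by rewrite t0_2 /trit; lia.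
  by rewrite (tx i ik) /trit; lia.
have zero i : i < k.+1 -> t i.+1 = 0.
  elim: i => [//|i IHi] ik; have := tN i.+1 ik;
    rewrite (IHi (ltnW ik)) /trit_next /=.
  by move/eqP.
exists 0 => // -[_|i ik]; first by have := t2 0 isT; rewrite /trit; lia.
by rewrite (zero i ik) /trit; lia.
Qed.

Lemma trit_copyP a x y j : x <= j ->
  (forall i, i <= j -> trit_copy a (i == 0) (trit x i) (trit y i)) ->
  y <= j.+1 -> y = apply_action a x.
Proof.
move=> xj copy yj; case: a copy => /= copy.
- by have := copy x xj; rewrite /trit; lia.
- have := copy x xj; have := copy x.+1; rewrite /trit.
  do ?case: ifP => ?; lia.
- have := copy x xj; have := copy x.-1 ltac:(lia); rewrite /trit.
  by case: x xj copy => [|x] xj copy /=; do ?case: ifP => ?; lia.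
Qed.

Lemma trit_copy_row a x j (t : nat -> nat) : x <= j -> t j.+1 <= 1 ->
  (forall i, i <= j.+1 -> t i <= 2) ->
  (forall i, i <= j -> trit_copy a (i == 0) (trit x i) (t i)) ->
  (forall i, i <= j -> trit_next (t i) (t i.+1)) ->
  forall i, i <= j.+1 -> t i = trit (apply_action a x) i.
Proof.
move=> xj t_last t2 copy tN.
have t0 : 0 < t 0.
  by have := copy 0 (leq0n j); rewrite /trit_copy /trit; case: (a) => /=;
    do ?case: ifP; lia.
have [y yj ty] := trit_rowP t0 t_last t2 tN.
suff <- : y = apply_action a x by [].
by apply: (trit_copyP xj _ yj) => i ij; rewrite -ty ?copy // leqW.
Qed.

Lemma trit_nextP x i : trit_next (trit x i) (trit x i.+1).
Proof. by rewrite /trit_next /trit; case: eqP; lia. Qed.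

Lemma trit_copy_apply_action a x i :
  trit_copy a (i == 0) (trit x i) (trit (apply_action a x) i).
Proof.
by case: a => /=; rewrite /trit; [|case: eqP|case: eqP]; do ?case: eqP => /=; lia.
Qed.

Lemma trit_eq1 x i : (trit x i == 1) = (i == x).
Proof. by rewrite /trit; lia. Qed.

Section Cells.
Variable e : expr.
Notation P := (search_program e).

Definition instr_reg (i : instr) : nat :=
  match i with IInc r _ | IDec r _ _ | IQuery r _ _ => r | ILoad => 0 end.

Definition cell_bound : nat := (size P + \max_(i <- P) instr_reg i).+1.

Lemma instr_reg_bound q : q < size P -> instr_reg (nth ILoad P q) < cell_bound.
Proof.
move=> qP; rewrite ltnS; apply: leq_trans (leq_addl _ _).
by rewrite (big_nth ILoad) big_mkord (leq_bigmax (Ordinal qP)).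
Qed.

Lemma search_addr_lt_size n W j : (search_conf e n W j).1 < size P.
Proof. by rewrite size_search_program ltnS search_conf_addr_le. Qed.

Lemma search_addr_bound n W j : (search_conf e n W j).1 < cell_bound.
Proof.
by rewrite ltnS ltnW // (leq_trans (search_addr_lt_size n W j)) // leq_addr.
Qed.

(* A cell records whether it starts and whether it ends its row, the value of
   the oracle at its index, the address of the machine, and the comparison of
   its index with every register. *)
Definition cell :=
  (bool * bool * bool * 'I_cell_bound * {ffun 'I_cell_bound -> 'I_3})%type.

Definition starts_row (c : cell) : bool := c.1.1.1.1.
Definition ends_row (c : cell) : bool := c.1.1.1.2.
Definition oracle_bit (c : cell) : bool := c.1.1.2.
Definition cell_addr (c : cell) : nat := c.1.2.
Definition cell_reg (c : cell) (r : 'I_cell_bound) : nat := c.2 r.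

Definition reg_action (i : instr) (r : nat) : action :=
  match i with
  | IInc r0 _ => if r == r0 then Up else Keep
  | IDec r0 _ _ => if r == r0 then Down else Keep
  | IQuery _ _ _ => Keep
  | ILoad => if r == 0 then Up else Keep
  end.

(* The first cell of the row knows whether the register [r] is zero, and the
   cell whose index is the value of [r] knows the answer to a query on [r]. *)
Definition addr_copy (i : instr) (c d : cell) : bool :=
  match i with
  | IInc _ q => cell_addr d == q
  | IDec r q1 q0 =>
      starts_row c ==>
        (cell_addr d == if cell_reg c (inord r) == 1 then q0 else q1)
  | IQuery r q1 q0 =>
      (cell_reg c (inord r) == 1) ==>
        (cell_addr d == if oracle_bit c then q1 else q0)
  | ILoad => (cell_addr d == cell_addr c) || (cell_addr d == 0)
  end.

Definition cell_next (c d : cell) : bool :=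
  if ends_row c then starts_row d
  else [&& ~~ starts_row d, cell_addr d == cell_addr c &
    [forall r, trit_next (cell_reg c r) (cell_reg d r)]].

Definition cell_copy (c d : cell) : bool :=
  let i := nth ILoad P (cell_addr c) in
  [&& starts_row d == starts_row c, ~~ ends_row d, oracle_bit d == oracle_bit c,
    addr_copy i c d &
    [forall r : 'I_cell_bound,
      trit_copy (reg_action i r) (starts_row c) (cell_reg c r) (cell_reg d r)]].

(* Only one cell is inserted in each row: its last one. *)
Definition cell_fresh (c : cell) : bool :=
  [&& ends_row c, ~~ starts_row c & [forall r, cell_reg c r <= 1]].

Definition cell_first (c : cell) : bool :=
  [&& starts_row c, ends_row c, cell_addr c == load_addr e &
    [forall r, cell_reg c r == 1]].

Definition cell_format : format cell :=
  Format cell_next cell_copy cell_fresh cell_first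
  (fun c => starts_row c && (cell_addr c == 0))
  (fun c => starts_row c && (cell_addr c == load_addr e))
  (fun c => cell_addr c == found_addr e).

Definition represents (W : pred nat) (cf : config) (i : nat) (c : cell) : Prop :=
  [/\ cell_addr c = cf.1, oracle_bit c = W i &
      forall r : 'I_cell_bound, cell_reg c r = trit (cf.2 r) i].

Lemma reg_inord W cf i c r : represents W cf i c -> r < cell_bound ->
  cell_reg c (inord r) = trit (cf.2 r) i.
Proof. by move=> [_ _ regs] rb; rewrite regs inordK. Qed.

Definition encode_cell (W : pred nat) (cf : config) (j i : nat) : cell :=
  (i == 0, i == j, W i, inord cf.1,
   [ffun r : 'I_cell_bound => inord (trit (cf.2 r) i)]).

Lemma encode_cell_represents n W k j i :
  represents W (search_conf e n W k) i (encode_cell W (search_conf e n W k) j i).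
Proof.
split=> [||r] //; first by rewrite /cell_addr inordK // search_addr_bound.
by rewrite /cell_reg ffunE inordK // ltnS geq_minl.
Qed.

Section Successor.
Variables (n : nat) (W : pred nat).
Notation conf := (search_conf e n W).

Lemma search_instr_load j : nth ILoad P (conf j).1 = ILoad -> j <= n.
Proof.
move=> load; rewrite leqNgt; apply/negP => nj.
by have := search_program_jumps (search_conf_addr_lt e W nj); rewrite load.
Qed.

Lemma search_instr_load_addr j : j <= n -> nth ILoad P (conf j).1 = ILoad.
Proof.
move=> jn; rewrite search_conf_load //=.
by have := search_program_after_test e 4; rewrite addnC.
Qed.

Lemma search_conf_succ_step j : nth ILoad P (conf j).1 <> ILoad ->
  conf j.+1 = run_instr W (nth ILoad P (conf j).1) (conf j).
Proof.
move=> no_load; rewrite search_confS // ltnNge; apply/negP.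
by move/search_instr_load_addr.
Qed.

Lemma search_conf_reg_succ j r :
  (conf j.+1).2 r =
  apply_action (reg_action (nth ILoad P (conf j).1) r) ((conf j).2 r).
Proof.
have [jn|nj] := leqP j n.
  rewrite search_instr_load_addr // (search_conf_load _ _ jn) /=.
  have -> : (conf j.+1).2 = update (fun=> 0) 0 j.+1.
    move: jn; rewrite leq_eqVlt => /orP[/eqP->|jn];
      first by rewrite search_conf_start.
    by rewrite search_conf_load.
  by rewrite /update; case: eqP.
rewrite search_conf_succ_step; last by move/search_instr_load; rewrite leqNgt nj.
have := search_program_jumps (search_conf_addr_lt e W nj).
case: (nth _ _ _) => [r0 q|r0 q1 q0|r0 q1 q0|] //= _; rewrite /update;
  by case: eqP => [->|].
Qed.

Lemma search_addr_zero j : (conf j).1 = 0 -> j = n.+1.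
Proof.
move=> addr0; have [jn|] := leqP j n; first by rewrite search_conf_load in addr0.
rewrite leq_eqVlt => /orP[/eqP //|/(search_conf_addr e W)].
by rewrite addr0.
Qed.

Lemma search_addr_load j : (conf j).1 = load_addr e -> j <= n.
Proof.
move=> load; rewrite leqNgt; apply/negP => /(search_conf_addr_lt e W).
by rewrite load ltnn.
Qed.

Lemma encode_cell_next j i : i < j ->
  cell_next (encode_cell W (conf j) j i) (encode_cell W (conf j) j i.+1).
Proof.
move=> ij; rewrite /cell_next [ends_row _]/ends_row /= ltn_eqF //.
have [-> _ regs] := encode_cell_represents n W j j i.
have [-> _ regsS] := encode_cell_represents n W j j i.+1.
by rewrite eqxx; apply/forallP => r; rewrite regs regsS; exact: trit_nextP.
Qed.

Lemma represents_addr_copy j i c d : represents W (conf j) i c ->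
  represents W (conf j.+1) i d -> starts_row c = (i == 0) ->
  addr_copy (nth ILoad P (conf j).1) c d.
Proof.
move=> rep_c; case=> addr_d _ _ start_c; have [addr_c bit_c _] := rep_c.
have := instr_reg_bound (search_addr_lt_size n W j).
case E: (nth _ _ _) => [r q|r q1 q0|r q1 q0|] /= rb; rewrite addr_d.
- by rewrite search_conf_succ_step ?E /= ?eqxx.
- rewrite search_conf_succ_step ?E //= start_c (reg_inord rep_c rb) trit_eq1.
  by apply/implyP => /eqP ->; rewrite [0 == _]eq_sym eqxx.
- rewrite search_conf_succ_step ?E //= (reg_inord rep_c rb) trit_eq1 bit_c.
  by apply/implyP => /eqP ->; rewrite eqxx.
have jn := search_instr_load E; rewrite addr_c (search_conf_load _ _ jn).
move: jn; rewrite leq_eqVlt => /orP[/eqP->|jn];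
  first by rewrite search_conf_start orbT.
by rewrite search_conf_load ?eqxx.
Qed.

Lemma encode_cell_copy j i : i <= j ->
  cell_copy (encode_cell W (conf j) j i) (encode_cell W (conf j.+1) j.+1 i).
Proof.
move=> ij; have rep := encode_cell_represents n W j j i.
have repS := encode_cell_represents n W j.+1 j.+1 i.
have [addr bit regs] := rep; have [_ bitS regsS] := repS.
rewrite /cell_copy addr; apply/and5P; split.
- exact: eqxx.
- by rewrite /ends_row /= ltn_eqF.
- by rewrite bit bitS.
- exact: represents_addr_copy rep repS _.
- by apply/forallP => r; rewrite regs regsS search_conf_reg_succ;
    exact: trit_copy_apply_action.
Qed.

End Successor.
End Cells.

Definition cell_index (j i : nat) : nat := 'C(j.+1, 2) + i.

Lemma cell_indexS j i : (cell_index j i).+1 = cell_index j i.+1.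
Proof. by rewrite /cell_index addnS. Qed.

Lemma cell_index_row_end j : (cell_index j j).+1 = cell_index j.+1 0.
Proof. by rewrite /cell_index addn0 [in RHS]binS bin1 addnS. Qed.

Lemma cell_index_surj p : exists j i, i <= j /\ p = cell_index j i.
Proof.
elim: p => [|p [j [i [ij ->]]]]; first by exists 0, 0.
move: ij; rewrite leq_eqVlt => /orP[/eqP->|ij].
  by exists j.+1, 0; rewrite cell_index_row_end.
by exists j, i.+1; rewrite cell_indexS.
Qed.

Lemma cell_index_row_le j k : j <= k -> cell_index j 0 <= cell_index k 0.
Proof. by move=> jk; rewrite /cell_index !addn0 leq_bin2l. Qed.

Lemma leq_cell_index j i : j <= cell_index j i.
Proof. by rewrite /cell_index binS bin1 -addnA addnCA leq_addr. Qed.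

Section Decode.
Variables (e : expr) (R : realType) (n : nat) (T : nat -> R) (c : nat -> cell e).
Hypothesis T_lt : {mono T : i j / i < j >-> (i < j)%R}.
Hypothesis wf : well_formed (cell_format e) n T (fun p => Some (c p)).

Let T_inj : injective T.
Proof. by move=> p q h; case: (ltngtP p q) => //; rewrite -T_lt h ltxx. Qed.

Definition is_copy (p q : nat) : Prop :=
  (T q = T p + 1)%R /\ cell_copy (c p) (c q).

Lemma exists_copy p : exists q, is_copy p q.
Proof. by have [q [_ Tq cq]] := wf_copy wf (erefl (Some (c p))); exists q. Qed.

Lemma starts_copy p q : is_copy p q -> starts_row (c q) = starts_row (c p).
Proof. by move=> [_ /and5P[/eqP]]. Qed.

Lemma starts_after_end p : ends_row (c p) -> starts_row (c p.+1).
Proof. by have := wf_next wf p; rewrite /= /cell_next => + h; rewrite h. Qed.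

Lemma not_starts_after_inner p : ~~ ends_row (c p) -> ~~ starts_row (c p.+1).
Proof.
by have := wf_next wf p; rewrite /= /cell_next => + /negPf h; rewrite h => /and3P[].
Qed.

Lemma is_copyS p q : is_copy p q ->
  if starts_row (c p.+1) then cell_fresh (c q.+1) /\ is_copy p.+1 q.+2
  else is_copy p.+1 q.+1.
Proof.
move=> copy_pq; have [Tq /and5P[_ inner_q _ _ _]] := copy_pq.
have [r copy_r] := exists_copy p.+1; have [Tr _] := copy_r.
have pq : p < q by rewrite -T_lt Tq ltrDl.
have qr : q < r by rewrite -T_lt Tq Tr ltrD2r T_lt.
have fresh s : q < s < r -> cell_fresh (c s).
  move=> /andP[qs sr]; apply: (wf_fresh wf (p := p)) => //.
  - exact: leq_ltn_trans pq qs.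
  - by rewrite -Tq T_lt.
  - by rewrite -Tr T_lt.
have inner_qS := not_starts_after_inner inner_q.
have [rq|nrq] := eqVneq r q.+1.
  by rewrite -(starts_copy copy_r) rq (negPf inner_qS) -rq.
have fresh_qS : cell_fresh (c q.+1) by apply: fresh; lia.
have start_qSS : starts_row (c q.+2).
  by apply: starts_after_end; case/and3P: fresh_qS.
have [rq|nrq2] := eqVneq r q.+2.
  by rewrite -(starts_copy copy_r) rq start_qSS -rq.
by have /and3P[_ /negP[]] : cell_fresh (c q.+2) by apply: fresh; lia.
Qed.

Definition is_row (j : nat) : Prop := forall i, i <= j ->
  starts_row (c (cell_index j i)) = (i == 0) /\
  ends_row (c (cell_index j i)) = (i == j).

Lemma row_copy j : is_row j -> is_copy (cell_index j 0) (cell_index j.+1 0) ->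
  forall i, i <= j -> is_copy (cell_index j i) (cell_index j.+1 i).
Proof.
move=> row copy0; elim=> // i IHi ij; have := is_copyS (IHi (ltnW ij)).
by rewrite !cell_indexS; have [-> _] := row i.+1 ij.
Qed.

Lemma next_row j : is_row j -> is_copy (cell_index j 0) (cell_index j.+1 0) ->
  [/\ is_row j.+1, cell_fresh (c (cell_index j.+1 j.+1)) &
      is_copy (cell_index j.+1 0) (cell_index j.+2 0)].
Proof.
move=> row copy0; have copy := row_copy row copy0.
have := is_copyS (copy j (leqnn j)); rewrite starts_after_end; last first.
  by have [_ ->] := row j (leqnn j).
rewrite cell_index_row_end cell_indexS cell_index_row_end => -[fresh copyS].
split=> // i; rewrite leq_eqVlt => /orP[/eqP->|ij].
  by case/and3P: fresh => -> /negPf ->; rewrite eqxx.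
rewrite (starts_copy (copy i ij)) (ltn_eqF ij); have [-> _] := row i ij.
by have [_ /and5P[_ /negPf ->]] := copy i ij.
Qed.

Lemma rows j : is_row j /\ is_copy (cell_index j 0) (cell_index j.+1 0).
Proof.
elim: j => [|j [row copy0]]; last by have [] := next_row row copy0.
have := wf_start wf; move=> /= first0; have [/= start0 end0 _ _] := and4P first0.
split; first by move=> i; rewrite leqn0 => /eqP ->; rewrite start0 end0.
have [q copy_q] := exists_copy 0; rewrite (_ : cell_index 1 0 = q) //.
by apply: T_inj; have [-> _] := copy_q; exact: (wf_first wf (p := 0)).
Qed.

Lemma rows_copy j i : i <= j -> is_copy (cell_index j i) (cell_index j.+1 i).
Proof. by have [row copy0] := rows j; exact: row_copy. Qed.

Lemma row_time j : (T (cell_index j 0) = T 0 + j%:R)%R.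
Proof.
elim: j => [|j IHj]; first by rewrite addr0.
by have [_ [-> _]] := rows j; rewrite IHj -addrA -natr1.
Qed.

Definition decoded_oracle : pred nat := fun i => oracle_bit (c (cell_index i i)).

Notation W := decoded_oracle.
Notation conf := (search_conf e n W).

Definition decoded_row (j : nat) : Prop :=
  forall i, i <= j -> represents W (conf j) i (c (cell_index j i)).

Lemma decoded_row0 : decoded_row 0.
Proof.
move=> i; rewrite leqn0 => /eqP ->.
have := wf_start wf; move=> /= /and4P[_ _ /eqP addr /forallP regs].
rewrite search_conf_load //; split=> // r.
by rewrite (eqP (regs r)) /= /update if_same.
Qed.

Section NextRow.
Variable j : nat.
Hypothesis row_j : decoded_row j.
Notation I := (nth ILoad (search_program e) (conf j).1).

Lemma copy_facts i : i <= j ->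
  [/\ oracle_bit (c (cell_index j.+1 i)) = W i,
      addr_copy I (c (cell_index j i)) (c (cell_index j.+1 i)) &
      forall r : 'I_(cell_bound e), trit_copy (reg_action I r) (i == 0)
        (trit ((conf j).2 r) i) (cell_reg (c (cell_index j.+1 i)) r)].
Proof.
move=> ij; have [addr bit regs] := row_j ij.
have [_ /and5P[_ _ /eqP -> copy_addr /forallP copy_regs]] := rows_copy ij.
split; rewrite ?bit -?addr // => r.
have [row _] := rows j; have [<- _] := row i ij.
by rewrite -regs; exact: copy_regs.
Qed.

Lemma next_facts i : i <= j ->
  cell_addr (c (cell_index j.+1 i.+1)) = cell_addr (c (cell_index j.+1 i)) /\
  forall r, trit_next (cell_reg (c (cell_index j.+1 i)) r)
    (cell_reg (c (cell_index j.+1 i.+1)) r).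
Proof.
move=> ij; have := wf_next wf (cell_index j.+1 i);
  rewrite /= cell_indexS /cell_next.
have [row _] := rows j.+1; have [_ ->] := row i (leqW ij); rewrite ltn_eqF //.
by move=> /and3P[_ /eqP -> /forallP].
Qed.

Lemma row_addr i : i <= j.+1 ->
  cell_addr (c (cell_index j.+1 i)) = cell_addr (c (cell_index j.+1 0)).
Proof.
by elim: i => // i IHi ij; have [-> _] := next_facts ij; exact: IHi (ltnW ij).
Qed.

(* The deadline forces the control to leave the loading address at the right
   time. *)
Lemma decoded_addr_load :
  I = ILoad -> cell_addr (c (cell_index j.+1 0)) = (conf j.+1).1.
Proof.
move=> load; have jn := search_instr_load load.
have [_ + _] := copy_facts (leq0n j); rewrite load /=.
have [-> _ _] := row_j (leq0n j); rewrite search_conf_load //=.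
have first0 := wf_start wf; have index_gt0 : 0 < cell_index j.+1 0
  by rewrite -cell_index_row_end.
have [row _] := rows j.+1; have [start _] := row 0 (leq0n j.+1).
case/orP=> /eqP addr; rewrite addr.
  suff j_lt : j < n by rewrite search_conf_load.
  rewrite ltn_neqAle jn andbT; apply/eqP => jn'.
  apply: (wf_off_deadline wf index_gt0 first0); last by rewrite row_time jn'.
  by rewrite /= start addr !eqxx.
have : cell_is (at_deadline (cell_format e)) (Some (c (cell_index j.+1 0)))
  by rewrite /= start addr !eqxx.
move=> /(wf_at_deadline wf index_gt0 first0); rewrite row_time => /addrI/eqP.
by rewrite eqr_nat eqSS => /eqP ->; rewrite search_conf_start.
Qed.

Lemma decoded_addr : cell_addr (c (cell_index j.+1 0)) = (conf j.+1).1.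
Proof.
have := instr_reg_bound (search_addr_lt_size e n W j).
case E: I => [r q|r q1 q0|r q1 q0|] /= rb; last exact: decoded_addr_load.
- rewrite search_conf_succ_step E //.
  by have [_ + _] := copy_facts (leq0n j); rewrite E => /eqP.
- rewrite search_conf_succ_step E //=.
  have [_ + _] := copy_facts (leq0n j); rewrite E /=.
  have [row _] := rows j; have [-> _] := row 0 (leq0n j).
  rewrite eqxx (reg_inord (row_j (leq0n j)) rb) trit_eq1 [0 == _]eq_sym.
  by move/eqP.
- rewrite search_conf_succ_step E //=.
  have xj := search_conf_reg e n W j r; rewrite -(row_addr (leqW xj)).
  have [_ + _] := copy_facts xj; have [_ bit _] := row_j xj.
  by rewrite E /= (reg_inord (row_j xj) rb) trit_eq1 eqxx bit => /eqP.
Qed.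

Lemma decoded_rowS : decoded_row j.+1.
Proof.
move=> i ij; split; first by rewrite row_addr // decoded_addr.
  move: ij; rewrite leq_eqVlt => /orP[/eqP-> //|ij].
  by have [-> _ _] := copy_facts ij.
move=> r; rewrite search_conf_reg_succ.
apply: (@trit_copy_row _ _ j (fun i => cell_reg (c (cell_index j.+1 i)) r)) ij.
- exact: search_conf_reg.
- have [row copy0] := rows j; have [_ fresh _] := next_row row copy0.
  by have /and3P[_ _ /forallP] := fresh; apply.
- by move=> k _; rewrite /cell_reg -ltnS ltn_ord.
- by move=> k kj; have [_ _] := copy_facts kj; apply.
- by move=> k kj; have [_] := next_facts kj; apply.
Qed.

End NextRow.

Lemma decoded_rowP j : decoded_row j.
Proof. by elim: j => [|j]; [exact: decoded_row0|exact: decoded_rowS]. Qed.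

Lemma decoded_recurrent : recurrent e n W.
Proof.
move=> N; have [p Np] := wf_signal wf (cell_index N 0); rewrite /= => /eqP found.
have [j [i [ij pE]]] := cell_index_surj p; exists j.
  rewrite leqNgt; apply/negP => jN.
  have : cell_index j.+1 0 <= cell_index N 0 by exact: cell_index_row_le.
  by move: Np; rewrite pE -cell_index_row_end /cell_index; lia.
by have [<- _ _] := decoded_rowP ij; rewrite -pE.
Qed.

End Decode.

(* The row [j] and the index [i] in it such that [p = cell_index j i]. *)
Fixpoint cell_pos (p : nat) : nat * nat :=
  if p is q.+1 then
    let: (j, i) := cell_pos q in if i == j then (j.+1, 0) else (j, i.+1)
  else (0, 0).

Lemma cell_pos_le p : (cell_pos p).2 <= (cell_pos p).1.
Proof.
elim: p => //= p; case: (cell_pos p) => j i /=; case: eqP => //= ij le_ij.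
by rewrite ltn_neqAle le_ij andbT; apply/eqP.
Qed.

Lemma cell_pos_index j i : i <= j -> cell_pos (cell_index j i) = (j, i).
Proof.
elim: j i => [|j IHj]; first by move=> i; rewrite leqn0 => /eqP ->.
elim=> [_|i IHi ij]; last by rewrite -cell_indexS /= (IHi (ltnW ij)) ltn_eqF.
by rewrite -cell_index_row_end /= IHj // eqxx.
Qed.

Section CellTimes.
Variable R : realType.
Local Open Scope ring_scope.

Definition offset (i : nat) : R := 1 - i.+1%:R^-1.

Lemma offset_lt : {mono offset : i j / (i < j)%N >-> i < j}.
Proof.
by move=> i j; rewrite ltrD2l ltrN2 ltf_pV2 ?posrE ?ltr0n // ltr_nat ltnS.
Qed.

Lemma offset0 : offset 0 = 0.
Proof. by rewrite /offset invr1 subrr. Qed.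

Lemma offset_bound i : 0 <= offset i < 1.
Proof.
rewrite subr_ge0 invf_le1 ?ltr0n // ler1n /=.
by rewrite ltrBlDr ltrDl invr_gt0 ltr0n.
Qed.

Definition cell_time (p : nat) : R :=
  (cell_pos p).1.+1%:R + offset (cell_pos p).2.

Lemma cell_time_row_start p :
  (cell_pos p).2 = 0%N -> cell_time p = (cell_pos p).1.+1%:R.
Proof. by rewrite /cell_time => ->; rewrite offset0 addr0. Qed.

Lemma cell_time_bound p :
  (cell_pos p).1.+1%:R <= cell_time p < (cell_pos p).1.+2%:R.
Proof.
have /andP[ge0 lt1] := offset_bound (cell_pos p).2.
by rewrite /cell_time lerDl ge0 -[_.+2%:R]natr1 ltrD2l.
Qed.

Lemma cell_time_ltS p : cell_time p < cell_time p.+1.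
Proof.
have /andP[_ upper] := cell_time_bound p; move: upper.
rewrite /cell_time /=; case: (cell_pos p) => j i; case: eqP => /= _ upper.
  by rewrite offset0 addr0.
by rewrite ltrD2l offset_lt.
Qed.

Lemma cell_time_lt : {mono cell_time : p q / (p < q)%N >-> p < q}.
Proof. exact: leW_mono (Order.NatMonotonyTheory.incnP cell_time_ltS). Qed.

Lemma cell_timeS_le p : cell_time p.+1 <= (cell_pos p).1.+2%:R.
Proof.
have /andP[_ /ltW upper] := cell_time_bound p.+1; move: upper.
rewrite /cell_time /=; case: (cell_pos p) => j i; case: eqP => //= _ _.
by rewrite offset0 addr0.
Qed.

Lemma cell_time_below_row p :
  cell_time (cell_index (cell_pos p).1.+1 (cell_pos p).2) = cell_time p + 1.
Proof.
rewrite /cell_time cell_pos_index ?(leqW (cell_pos_le p)) //=.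
by rewrite -[_.+2%:R]natr1 addrAC.
Qed.

Lemma between_copies_row_end p q :
  cell_time p + 1 < cell_time q -> cell_time q < cell_time p.+1 + 1 ->
  exists j, cell_pos q = (j.+1, j.+1).
Proof.
move=> lo up.
have row_q : (cell_pos q).1 = (cell_pos p).1.+1.
  have /andP[p_lo _] := cell_time_bound p;
    have /andP[q_lo q_up] := cell_time_bound q.
  have := cell_timeS_le p; move: p_lo q_lo q_up;
    rewrite -!natr1 => p_lo q_lo q_up p_up.
  by apply/eqP; rewrite eqn_leq -ltnS -!(ltr_nat R) -!natr1; apply/andP;
    split; lra.
have [j [i [ij pE]]] := cell_index_surj p; have posp : cell_pos p = (j, i)
  by rewrite pE cell_pos_index.
have := cell_pos_le q; case posq: (cell_pos q) row_q => [j' i'];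
  rewrite posp => /= j'E i'j.
subst j'.
have ii' : (i < i')%N.
  by rewrite -offset_lt; move: lo;
    rewrite /cell_time posp posq /= -[j.+2%:R]natr1; lra.
move: i'j; rewrite leq_eqVlt => /orP[/eqP i'E|]; first by exists j; rewrite i'E.
rewrite ltnS => i'j;
  have i_neq_j : (i == j) = false by rewrite ltn_eqF // (leq_trans ii').
have : offset i' < offset i.+1.
  by move: up; rewrite /cell_time /= posp posq i_neq_j /= -[j.+2%:R]natr1; lra.
by rewrite offset_lt ltnS leqNgt ii'.
Qed.

End CellTimes.

Section Encode.
Variables (R : realType) (e : expr) (n : nat) (W : pred nat) (b : R).
Hypothesis rec : recurrent e n W.
Notation conf := (search_conf e n W).
Notation T := (fun p => b + cell_time R p)%R.

Definition encoded (p : nat) : cell e :=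
  encode_cell e W (conf (cell_pos p).1) (cell_pos p).1 (cell_pos p).2.

Lemma encoded_represents p :
  represents W (conf (cell_pos p).1) (cell_pos p).2 (encoded p).
Proof. exact: encode_cell_represents. Qed.

Lemma starts_encoded p : starts_row (encoded p) = ((cell_pos p).2 == 0).
Proof. by []. Qed.

Lemma ends_encoded p : ends_row (encoded p) = ((cell_pos p).2 == (cell_pos p).1).
Proof. by []. Qed.

Lemma encoded_first : cell_first (encoded 0).
Proof.
have [addr _ regs] := encoded_represents 0.
apply/and4P; split=> //; first by rewrite addr search_conf_load.
by apply/forallP => r; rewrite regs search_conf_load //= /update if_same.
Qed.

Lemma cell_pos_first p : cell_first (encoded p) -> cell_pos p = (0, 0).
Proof.
case/and4P; rewrite starts_encoded ends_encoded => /eqP i0 /eqP ij _ _.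
by rewrite [LHS]surjective_pairing -ij i0.
Qed.

Lemma encoded_next p : cell_next (encoded p) (encoded p.+1).
Proof.
have := cell_pos_le p; rewrite /encoded /=; case: (cell_pos p) => j i /= ij.
case: (eqVneq i j) => [->|nij] /=; first by rewrite /cell_next /ends_row /= eqxx.
by apply: encode_cell_next; rewrite ltn_neqAle nij.
Qed.

Lemma encoded_copy p : exists q,
  [/\ p < q, T q = (T p + 1)%R & cell_copy (encoded p) (encoded q)].
Proof.
exists (cell_index (cell_pos p).1.+1 (cell_pos p).2);
  rewrite cell_time_below_row addrA; split=> //.
  by rewrite -(cell_time_lt R) cell_time_below_row ltrDl.
rewrite /encoded cell_pos_index ?(leqW (cell_pos_le p)) //.
exact: encode_cell_copy (cell_pos_le p).
Qed.

Lemma encoded_fresh p q : (T p + 1 < T q)%R -> (T q < T p.+1 + 1)%R ->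
  cell_fresh (encoded q).
Proof.
move=> lo up; have [j posq] : exists j, cell_pos q = (j.+1, j.+1).
  by apply: (@between_copies_row_end R p q); move: lo up => /=; lra.
rewrite /cell_fresh ends_encoded starts_encoded posq eqxx /=; apply/forallP => r.
have [_ _ ->] := encoded_represents q.
by have := search_conf_reg e n W j.+1 r; rewrite posq /trit /=; lia.
Qed.

Lemma row_start_time p q : cell_pos p = (0, 0) -> starts_row (encoded q) ->
  T q = (T p + (cell_pos q).1%:R)%R.
Proof.
rewrite starts_encoded => posp /eqP i0.
by rewrite !cell_time_row_start ?posp // -addrA -natrD add1n.
Qed.

Lemma encoded_at_deadline p q : cell_first (encoded p) ->
  starts_row (encoded q) && (cell_addr (encoded q) == 0) ->
  T q = (T p + n.+1%:R)%R.
Proof.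
move=> /cell_pos_first posp /andP[start_q]; have [-> _ _] := encoded_represents q.
by move=> /eqP/search_addr_zero <-; exact: row_start_time.
Qed.

Lemma encoded_off_deadline p q : cell_first (encoded p) ->
  starts_row (encoded q) && (cell_addr (encoded q) == load_addr e) ->
  T q <> (T p + n.+1%:R)%R.
Proof.
move=> /cell_pos_first posp /andP[start_q]; have [-> _ _] := encoded_represents q.
move=> /eqP/search_addr_load row_q;
  rewrite (row_start_time posp start_q) => /addrI/eqP.
by rewrite eqr_nat => /eqP row_qE; rewrite row_qE ltnn in row_q.
Qed.

Lemma encoded_well_formed :
  well_formed (cell_format e) n T (fun p => Some (encoded p)).
Proof.
split=> //=.
- exact: encoded_first.
- exact: encoded_next.
- by move=> p _ [<-]; exact: encoded_copy.
- by move=> p q _ _; exact: encoded_fresh.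
- by move=> p q _; exact: encoded_at_deadline.
- by move=> p q _; exact: encoded_off_deadline.
- move=> p /cell_pos_first posp; rewrite !cell_time_row_start /= posp //=.
  by rewrite -[(2%:R)%R]natr1 addrA.
- move=> N; have [j Nj addr] := rec N; exists (cell_index j 0);
    first exact: leq_trans Nj (leq_cell_index j 0).
  by have [-> _ _] := encoded_represents (cell_index j 0);
    rewrite cell_pos_index // addr.
Qed.

End Encode.

(** * The reduction *)

Definition reduction_format (p : form) : format (cell (refutation_expr p)) :=
  cell_format (refutation_expr p).

Definition reduction (p : form) (n : nat) : tba_instance :=
  existT _ _ (detector (reduction_format p) n).

Section Reduction.
Variables (R : realType) (B : set nat) (p : form).
Hypothesis arith_p : arithmetical p.
Hypothesis B_p : forall n, B n <-> forall E, holds (scons n (fun=> 0)) E p.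

Notation e := (refutation_expr p).
Notation reduce n := (tagged (reduction p n)).

Lemma not_mem_recurrent n : ~ B n <-> exists W, recurrent e n W.
Proof.
have rec W : recurrent e n W <-> forall m, exists y, refutation_test W p n m y.
  by apply: recurrentP => rho rho0; rewrite true_refutation rho0.
rewrite B_p; transitivity (exists E, ~ holds (scons n (fun=> 0)) E p).
  by split=> [/existsNP|[E hE] h]; [|apply: hE].
by rewrite refutationP //; split=> -[W /rec hW]; exists W.
Qed.

Lemma lang_reduction_mem n : B n -> lang (reduce n) = [set: timed_word R _].
Proof.
move=> Bn; apply/seteqP; split=> // w _;
  apply/lang_detector => /well_formed_cells[k [c wf]].
suff : ~ B n by [].
apply/not_mem_recurrent; exists (decoded_oracle c);
  apply: decoded_recurrent wf => i j.
by rewrite event_time_lt ltn_add2l.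
Qed.

Lemma lang_reduction_not_mem n :
  ~ B n -> exists a (u : timed_word R (tag (reduction p n))),
  detects_unit_gaps a u (lang (reduce n)).
Proof.
move=> /not_mem_recurrent[W rec].
have [|u [uT ul]] :=
  word_of_times (fun q => enum_rank (Some (encoded e n W q))) _ (@cell_time_ltS R).
  by rewrite cell_time_row_start.
exists (enum_rank None), u => w L wL wu; rewrite lang_detector.
have blank q : q < L -> letter w q = None.
  by move=> qL; rewrite /letter wL // enum_rankK.
split=> [ill_formed|[q [r [/andP[qr rL] Tr]]] wf]; last first.
  by apply: (wf_blank wf qr) Tr; apply: blank => //; exact: ltn_trans rL.
apply: contrapT => no_gap; apply: ill_formed.
apply: (@well_formed_prepend _ _ _ _ _ _ (encoded e n W) L) => //.
- by move=> q; rewrite /letter wu ul enum_rankK.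
- by move=> q r qr Tr; apply: no_gap; exists q, r.
rewrite (_ : (fun q => _) = fun q => (elapsed w L + cell_time R q)%R).
  exact: encoded_well_formed.
apply/funext => q; rewrite -uT; elim: q => [|q IHq].
  by rewrite event_time0 -wu addn0 -elapsedS.
by rewrite addnS !event_timeS IHq -addnS wu addrA.
Qed.

Lemma determinizable_reduction n : B n <-> determinizable R (reduce n).
Proof.
split=> [Bn|[D detD langD]].
  exists (universal_tba _); first exact: universal_deterministic.
  by rewrite lang_universal lang_reduction_mem.
apply: contrapT => /lang_reduction_not_mem[a [u gaps]].
exact: (deterministic_neq_unit_gaps gaps detD langD).
Qed.

Lemma complementable_reduction n : B n <-> complementable R (reduce n).
Proof.
split=> [Bn|[C langC]].
  by exists (empty_tba _); rewrite lang_empty lang_reduction_mem // setCT.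
apply: contrapT => /lang_reduction_not_mem[a [u gaps]].
exact: (lang_neq_compl_unit_gaps gaps langC).
Qed.

End Reduction.

Theorem theorem9 (R : realType) :
  pi11_hard tba_code [set A : tba_instance | determinizable R (tagged A)] /\
  pi11_hard tba_code [set A : tba_instance | complementable R (tagged A)].
Proof.
split=> B /pi11_normal_form[p arith_p B_p]; exists (reduction p);
  do ?exact: computable_detector.
- by move=> n; exact: determinizable_reduction.
- by move=> n; exact: complementable_reduction.
Qed.
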